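(* Let $T>0$ and $\omega=\frac{2\pi}{T}$. Assume that the function $e(t)\in C(\mathbb{R})$ is $T$-periodic, with $\int_0^T e(t)\,dt=0$, and $a,c\in\mathbb{R}$. Assume also that $$a\,\frac{3^5}{5^5}<\omega^2\qquad\text{and}\qquad \frac{\sqrt{3T}\,\|e(t)\|_{L^2[0,T]}}{|c|}<1 .$$ For $\mu\in\mathbb{R}$ consider the problem $$u''(t)+c\,u'(t)+a\left(\frac{1}{u^4(t)}-\frac{1}{u^3(t)}\right)=\mu+e(t),\qquad u(t+T)=u(t).\qquad ( * )$$ If we decompose $u(t)=\xi+U(t)$ with $\int_0^T U(t)\,dt=0$, then the value of $\xi$ is a global parameter, uniquely identifying the solution pair $(u(t),\mu)$, and all positive $T$-periodic solutions of $( * )$ lie on a unique continuous curve $\mu=\varphi(\xi)$, defined for all $\xi\in(0,\infty)$. There is a point $\xi_0>0$, with $\mu_0=\varphi(\xi_0)<0$, so that the function $\varphi(\xi)$ is decreasing on $(0,\xi_0)$ and increasing on $(\xi_0,\infty)$, and we have $$\lim_{\xi\to 0}\varphi(\xi)=\infty,\qquad \lim_{\xi\to\infty}\varphi(\xi)=0 .$$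
   Context: A solution pair is $(u,\mu)$ with $\mu\in\mathbb{R}$ and $u$ a positive $T$-periodic solution of $( * )$ for that value of $\mu$; positive means $u(t)>0$ for all $t$. The number $\xi=\frac1T\int_0^T u(t)\,dt$ is the average of $u$.
   Formalization: The formal statement assumes a > 0 where the text allows any real a; for a = 0 every solution has μ = 0, and for a < 0 μ is bounded above, so the claim fails for all a ≤ 0. It also states c ≠ 0, implicit in dividing by |c|. *)

(* Defs.v *)
From Stdlib Require Import Reals.
From Coquelicot Require Import Coquelicot.
Open Scope R_scope.

Definition periodic (T : R) (f : R -> R) : Prop :=
  forall t, f (t + T) = f t.

Definition L2norm (T : R) (f : R -> R) : R :=
  sqrt (RInt (fun t => f t ^ 2) 0 T).

(* [average T u] is the unique [xi] such that [U := u - xi] satisfies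
   [RInt U 0 T = 0] (for continuous [u] and [T > 0]). *)
Definition average (T : R) (u : R -> R) : R :=
  1 / T * RInt u 0 T.

(* [Derive] is total, so both differentiability requirements are needed to
   make [u] a classical solution. *)
Definition solves_ode (a c : R) (e : R -> R) (u : R -> R) (mu : R) : Prop :=
  forall t, ex_derive u t /\ ex_derive (Derive u) t /\
    Derive (Derive u) t + c * Derive u t + a * (1 / u t ^ 4 - 1 / u t ^ 3)
      = mu + e t.

Definition solution_pair (T a c : R) (e : R -> R) (u : R -> R) (mu : R) : Prop :=
  (forall t, 0 < u t) /\ periodic T u /\ solves_ode a c e u mu.

(* Only the values of [phi] on (0, oo) matter: [average T u > 0] whenever
   [u > 0], and (0, oo) is open, so continuity on it is pointwise continuity. *)
Definition solution_curve (T a c : R) (e : R -> R) (phi : R -> R) : Prop :=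
  (forall xi, 0 < xi -> continuous phi xi) /\
  (forall u mu, solution_pair T a c e u mu -> mu = phi (average T u)) /\
  (forall xi, 0 < xi ->
     exists u, solution_pair T a c e u (phi xi) /\ average T u = xi).

(* Main.v *)
Require Import Defs.
From Stdlib Require Import Reals ZArith Lra Lia ClassicalEpsilon.
From Coquelicot Require Import Coquelicot.
Open Scope R_scope.

(** Write [g u = u^-4 - u^-3] and [M = 3^5 / 5^5], which is the maximum of [g'], attained at [5 / 3].
    The hypothesis [a M < omega^2] says that the linearized force [a g' u] always stays below the
    first nonzero eigenvalue of [- u''] on the circle of length [T], so testing with functions of
    mean zero and using the Wirtinger inequality absorbs the force into the energy [int w'^2]; the
    damping term drops out because it is skew. Fixing the average of [u] removes exactly the
    constants from the problem and leaves [mu] as a multiplier. Consequently a solution with given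
    average is unique and depends on the average in a Lipschitz and even differentiable way
    ([coercivity], [solution_lipschitz], [solution_differentiable]), and it exists for every
    positive average ([periodic_solution_exists], a contraction in the energy norm).

    The singularity is harmless because of a maximum principle: the equation at a maximum of [u]
    bounds [mu] from above, as the maximum exceeds the average, and at a minimum it then bounds
    [g u], hence keeps [u] away from zero ([truncation_threshold]). The same two inequalities
    give [phi -> oo] at zero. Testing with [u'] gives [|c| ||u'|| <= ||e||], so the smallness of [e]
    makes the oscillation of every solution less than [1 / 3] ([solution_oscillation]); this yields
    [phi -> 0] from below at infinity.

    The shape of [phi] follows from the absence of local maxima ([no_local_max]). At such a point
    the slope of [phi] is zero, so the derivative [z] of [u] with respect to its average lies in the
    kernel of the linearized operator. Eigenvalue comparison on nodal arcs makes [z] positive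
    ([kernel_positive]), hence the neighbouring solutions [v < u < w] on the curve are ordered.
    Integrating the equation of [z] shows that [u] takes the value [4 / 3], the zero of [g'], and the
    bound on the oscillation puts all three solutions below [5 / 3], where [g] is strictly convex.
    Comparing [w - u] with a multiple of [u - v] that touches it from below contradicts this
    convexity ([no_ordered_triple]). A continuous function without local maxima which is [oo] at
    zero and tends to [0] from below at infinity decreases to a global minimum and increases
    afterwards ([unimodal_of_no_local_max]). *)

(** * Continuity, derivatives and integrals *)

Definition cont (f : R -> R) : Prop := forall t, continuous f t.

Definition has_deriv (f f' : R -> R) : Prop := forall t, is_derive f t (f' t).

Lemma cont_const (k : R) : cont (fun _ => k).
Proof. intro t; apply continuous_const. Qed.

Lemma cont_id : cont (fun t => t).
Proof. intro t; apply continuous_id. Qed.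

Lemma cont_plus f g : cont f -> cont g -> cont (fun t => f t + g t).
Proof. intros Hf Hg t; apply (continuous_plus f g); auto. Qed.

Lemma cont_opp f : cont f -> cont (fun t => - f t).
Proof. intros Hf t; apply (continuous_opp f); auto. Qed.

Lemma cont_minus f g : cont f -> cont g -> cont (fun t => f t - g t).
Proof. intros Hf Hg t; apply (continuous_minus f g); auto. Qed.

Lemma cont_mult f g : cont f -> cont g -> cont (fun t => f t * g t).
Proof. intros Hf Hg t; apply (continuous_mult f g); auto. Qed.

Lemma cont_pow f n : cont f -> cont (fun t => f t ^ n).
Proof.
  intros Hf; induction n as [|n IH]; simpl.
  - apply cont_const.
  - now apply cont_mult.
Qed.

Lemma cont_comp f h : cont f -> (forall t, continuous h (f t)) -> cont (fun t => h (f t)).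
Proof. intros Hf Hh t; apply continuous_comp; auto. Qed.

Lemma cont_shift f s : cont f -> cont (fun t => f (t + s)).
Proof.
  intros Hf; apply (cont_comp (fun t => t + s)); [|intro; apply Hf].
  apply cont_plus; [apply cont_id | apply cont_const].
Qed.

Lemma has_deriv_cont f f' : has_deriv f f' -> cont f.
Proof. intros H t; apply (ex_derive_continuous f t); exists (f' t); apply H. Qed.

Ltac solve_cont :=
  lazymatch goal with
  | |- cont (fun _ => ?k) => apply (cont_const k)
  | |- cont (fun t => t) => exact cont_id
  | |- cont (fun t => @?f t + @?g t) => apply (cont_plus f g); solve_cont
  | |- cont (fun t => @?f t - @?g t) => apply (cont_minus f g); solve_cont
  | |- cont (fun t => - @?f t) => apply (cont_opp f); solve_cont
  | |- cont (fun t => @?f t * @?g t) => apply (cont_mult f g); solve_cont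
  | |- cont (fun t => @?f t ^ ?n) => apply (cont_pow f n); solve_cont
  | |- cont (fun t => ?f (t + ?s)) => apply (cont_shift f s); solve_cont
  | |- cont (fun t => ?f t) => change (cont f); solve_cont
  | H : cont ?f |- cont ?f => exact H
  | H : has_deriv ?f _ |- cont ?f => exact (has_deriv_cont _ _ H)
  end.

Lemma has_deriv_ext f f' g g' :
  (forall t, f t = g t) -> (forall t, f' t = g' t) -> has_deriv f f' -> has_deriv g g'.
Proof.
  intros H1 H2 H t. rewrite <- H2. now apply is_derive_ext with f.
Qed.

Lemma has_deriv_const k : has_deriv (fun _ => k) (fun _ => 0).
Proof. intro t; apply (is_derive_const k). Qed.

Lemma has_deriv_plus f f' g g' :
  has_deriv f f' -> has_deriv g g' -> has_deriv (fun t => f t + g t) (fun t => f' t + g' t).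
Proof. intros Hf Hg t; apply (is_derive_plus f g); auto. Qed.

Lemma has_deriv_minus f f' g g' :
  has_deriv f f' -> has_deriv g g' -> has_deriv (fun t => f t - g t) (fun t => f' t - g' t).
Proof. intros Hf Hg t; apply (is_derive_minus f g); auto. Qed.

Lemma has_deriv_scal k f f' :
  has_deriv f f' -> has_deriv (fun t => k * f t) (fun t => k * f' t).
Proof. intros Hf t; apply is_derive_scal; auto. Qed.

Lemma has_deriv_mult f f' g g' :
  has_deriv f f' -> has_deriv g g' ->
  has_deriv (fun t => f t * g t) (fun t => f' t * g t + f t * g' t).
Proof.
  intros Hf Hg t; apply (is_derive_mult f g); auto. intros; apply Rmult_comm.
Qed.

Lemma has_deriv_shift f f' s :
  has_deriv f f' -> has_deriv (fun t => f (t + s)) (fun t => f' (t + s)).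
Proof.
  intros Hf t.
  replace (f' (t + s)) with (1 * f' (t + s)) by ring.
  apply (is_derive_comp f (fun t => t + s)); [apply Hf|].
  auto_derive; auto.
Qed.

Lemma has_deriv_unique f f' g' :
  has_deriv f f' -> has_deriv f g' -> forall t, f' t = g' t.
Proof.
  intros H1 H2 t. rewrite <- (is_derive_unique _ _ _ (H1 t)).
  apply is_derive_unique, H2.
Qed.

Lemma mean_value f f' a b :
  has_deriv f f' -> a < b -> exists s, a < s < b /\ f b - f a = f' s * (b - a).
Proof.
  intros Hf Hab. destruct (MVT_cor2 f f' a b Hab) as [s [H1 H2]].
  - intros; apply is_derive_Reals, Hf.
  - now exists s.
Qed.

Lemma ex_RInt_cont f a b : cont f -> ex_RInt f a b.
Proof. intros Hf; apply (ex_RInt_continuous f); intros; apply Hf. Qed.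

Lemma RInt_deriv f f' a b : has_deriv f f' -> cont f' -> RInt f' a b = f b - f a.
Proof.
  intros Hf Hf'. apply is_RInt_unique. apply (is_RInt_derive f f'); intros; auto.
Qed.

Lemma RInt_add f g a b : cont f -> cont g ->
  RInt (fun t => f t + g t) a b = RInt f a b + RInt g a b.
Proof. intros; apply (RInt_plus f g); now apply ex_RInt_cont. Qed.

Lemma RInt_sub f g a b : cont f -> cont g ->
  RInt (fun t => f t - g t) a b = RInt f a b - RInt g a b.
Proof. intros; apply (RInt_minus f g); now apply ex_RInt_cont. Qed.

Lemma RInt_cmul k f a b : cont f -> RInt (fun t => k * f t) a b = k * RInt f a b.
Proof. intros; apply (RInt_scal f); now apply ex_RInt_cont. Qed.

Lemma RInt_cst k a b : RInt (fun _ => k) a b = (b - a) * k.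
Proof. apply (RInt_const a b k). Qed.

Lemma RInt_mono f g a b : a <= b -> cont f -> cont g -> (forall t, f t <= g t) ->
  RInt f a b <= RInt g a b.
Proof. intros; apply RInt_le; auto; now apply ex_RInt_cont. Qed.

Lemma RInt_nonneg f a b : a <= b -> cont f -> (forall t, 0 <= f t) -> 0 <= RInt f a b.
Proof.
  intros Hab Hf H.
  assert (E : 0 = RInt (fun _ => 0) a b) by (rewrite RInt_cst; ring).
  rewrite E. apply RInt_mono; auto. apply cont_const.
Qed.

Lemma RInt_concat f a b d : cont f -> RInt f a d = RInt f a b + RInt f b d.
Proof. intros Hf; symmetry; apply (RInt_Chasles f); now apply ex_RInt_cont. Qed.

Lemma RInt_point_zero (f : R -> R) a : RInt f a a = 0.
Proof. apply (RInt_point a f). Qed.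

Lemma RInt_same (f g : R -> R) a b : (forall t, f t = g t) -> RInt f a b = RInt g a b.
Proof. intros H; apply RInt_ext; auto. Qed.

Lemma has_deriv_RInt f s : cont f -> has_deriv (fun t => RInt f s t) f.
Proof.
  intros Hf t. apply (is_derive_RInt f (fun t => RInt f s t) s t); [|apply Hf].
  apply filter_forall; intro x. apply (RInt_correct f). now apply ex_RInt_cont.
Qed.

Lemma RInt_mean_value f a b : cont f -> a < b ->
  exists s, a < s < b /\ f s * (b - a) = RInt f a b.
Proof.
  intros Hf Hab.
  destruct (mean_value _ _ a b (has_deriv_RInt f a Hf) Hab) as [s [H1 H2]].
  exists s; split; auto. rewrite <- H2, RInt_point_zero. apply Rminus_0_r.
Qed.

Lemma nonneg_quadratic A B C : (forall l, 0 <= A + 2 * l * B + l ^ 2 * C) -> B ^ 2 <= A * C.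
Proof.
  intros H.
  assert (HA : 0 <= A) by (specialize (H 0); lra).
  destruct (Req_dec C 0) as [->|HC].
  - destruct (Req_dec B 0) as [->|HB]; [nra|].
    specialize (H (- (A + 1) / (2 * B))).
    assert (E : A + 2 * (- (A + 1) / (2 * B)) * B + (- (A + 1) / (2 * B)) ^ 2 * 0 = -1)
      by (field; auto). lra.
  - assert (HC' : 0 < C).
    { destruct (Rtotal_order C 0) as [h|[h|h]]; [|lra|lra].
      (* this l makes l C = C - (A + 2 |B|), so the value at l is negative *)
      set (l := 1 + (A + 2 * Rabs B) / (- C)).
      assert (Hq : 0 <= (A + 2 * Rabs B) / (- C)).
      { apply Rmult_le_pos; [pose proof (Rabs_pos B); lra|].
        left; apply Rinv_0_lt_compat; lra. }
      assert (Hl : 1 <= l) by (unfold l; lra).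
      specialize (H l).
      assert (E : l * C = C - (A + 2 * Rabs B)) by (unfold l; field; lra).
      pose proof (Rle_abs B). 
      replace (l ^ 2 * C) with (l * (l * C)) in H by ring. rewrite E in H. nra. }
    specialize (H (- B / C)).
    replace (A + 2 * (- B / C) * B + (- B / C) ^ 2 * C) with ((A * C - B ^ 2) / C) in H
      by (field; auto).
    apply Rmult_le_compat_r with (r := C) in H; [|lra].
    replace ((A * C - B ^ 2) / C * C) with (A * C - B ^ 2) in H by (field; auto). lra.
Qed.

Lemma Cauchy_Schwarz f g a b : a <= b -> cont f -> cont g ->
  RInt (fun t => f t * g t) a b ^ 2 <= RInt (fun t => f t ^ 2) a b * RInt (fun t => g t ^ 2) a b.
Proof.
  intros Hab Hf Hg. apply nonneg_quadratic. intro l.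
  rewrite <- (RInt_cmul (2 * l)), <- (RInt_cmul (l ^ 2)), <- !RInt_add by solve_cont.
  apply RInt_nonneg; auto; [solve_cont|].
  intro t. replace (_ + _ + _) with ((f t + l * g t) ^ 2) by ring. apply pow2_ge_0.
Qed.

(** Cauchy-Schwarz against the constant [1]. *)
Lemma increment_sqr_le f f' a b : a <= b -> has_deriv f f' -> cont f' ->
  (f b - f a) ^ 2 <= (b - a) * RInt (fun t => f' t ^ 2) a b.
Proof.
  intros Hab Hf Hf'.
  pose proof (Cauchy_Schwarz (fun _ => 1) f' a b Hab (cont_const 1) Hf') as H.
  rewrite (RInt_same (fun t => 1 * f' t) f'), (RInt_same (fun t => 1 ^ 2) (fun _ => 1)) in H
    by (intro; ring).
  rewrite (RInt_deriv f f'), RInt_cst, Rmult_1_r in H; auto.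
Qed.

(** * Periodic functions *)

Lemma periodic_Z T f : periodic T f -> forall n t, f (t + IZR n * T) = f t.
Proof.
  intros Hp.
  assert (Hn : forall n t, f (t + INR n * T) = f t).
  { induction n as [|n IH]; intro t; [f_equal; simpl; ring|].
    rewrite S_INR. replace (t + (INR n + 1) * T) with (t + INR n * T + T) by ring.
    now rewrite Hp. }
  intros n t. destruct (Z.le_ge_cases 0 n) as [H|H].
  - rewrite <- (Z2Nat.id n H), <- INR_IZR_INZ. apply Hn.
  - rewrite <- (Hn (Z.to_nat (- n)) (t + IZR n * T)).
    f_equal. rewrite INR_IZR_INZ, Z2Nat.id, opp_IZR by lia. ring.
Qed.

Lemma period_window T x y : 0 < T ->
  exists x', y <= x' < y + T /\ forall f, periodic T f -> f x' = f x.
Proof.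
  intros HT.
  destruct (archimed ((y - x) / T)) as [H1 H2].
  set (n := up ((y - x) / T)) in *.
  assert (E : (y - x) = (y - x) / T * T) by (field; lra).
  destruct (Rlt_dec (x + IZR n * T) (y + T)) as [h|h].
  - exists (x + IZR n * T). split; [split; [nra|auto]|].
    intros f Hf; now apply periodic_Z.
  - exists (x + IZR (n - 1) * T). rewrite minus_IZR. split; [split; nra|].
    intros f Hf. rewrite <- minus_IZR. now apply periodic_Z.
Qed.

Lemma RInt_period T f s : cont f -> periodic T f -> RInt f s (s + T) = RInt f 0 T.
Proof.
  intros Hf Hp.
  rewrite (RInt_concat f s 0 (s + T)), (RInt_concat f 0 T (s + T)) by auto.
  assert (E : RInt f T (s + T) = RInt f 0 s).
  { replace (RInt f T (s + T)) with (RInt f (1 * 0 + T) (1 * s + T)) by (f_equal; ring).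
    rewrite <- (RInt_comp_lin f 1 T 0 s) by now apply ex_RInt_cont.
    apply RInt_same. intro t. change (1 * f (1 * t + T) = f t). rewrite !Rmult_1_l. apply Hp. }
  rewrite E. pose proof (RInt_concat f s 0 s Hf) as E2.
  rewrite RInt_point_zero in E2. lra.
Qed.

Lemma periodic_max T f : 0 < T -> cont f -> periodic T f -> exists m, forall t, f t <= f m.
Proof.
  intros HT Hf Hp.
  destruct (continuity_ab_maj f 0 T) as [m [H1 H2]]; [lra| |].
  - intros; apply continuity_pt_filterlim, Hf.
  - exists m. intro t. destruct (period_window T t 0 HT) as [t' [H3 H4]].
    rewrite <- (H4 f Hp). apply H1. lra.
Qed.

Lemma periodic_min T f : 0 < T -> cont f -> periodic T f -> exists m, forall t, f m <= f t.
Proof.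
  intros HT Hf Hp.
  destruct (periodic_max T (fun t => - f t) HT) as [m H].
  - solve_cont.
  - intro t; now rewrite Hp.
  - exists m; intro t; specialize (H t); lra.
Qed.

Lemma periodic_bounded T f : 0 < T -> cont f -> periodic T f ->
  exists B, 0 <= B /\ forall t, Rabs (f t) <= B.
Proof.
  intros HT Hf Hp.
  destruct (periodic_max T f HT Hf Hp) as [m H1].
  destruct (periodic_min T f HT Hf Hp) as [n H2].
  exists (Rabs (f m) + Rabs (f n)). split.
  - pose proof (Rabs_pos (f m)); pose proof (Rabs_pos (f n)); lra.
  - intro t. apply Rabs_le. specialize (H1 t); specialize (H2 t).
    pose proof (Rle_abs (f m)); pose proof (Rle_abs (- f n)).
    pose proof (Rabs_pos (f m)); pose proof (Rabs_pos (f n)).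
    rewrite Rabs_Ropp in *. lra.
Qed.

Lemma periodic_deriv T f f' : has_deriv f f' -> periodic T f -> periodic T f'.
Proof.
  intros Hd Hp.
  intro s. apply (has_deriv_unique f (fun t => f' (t + T)) f'); auto.
  apply (has_deriv_ext (fun t => f (t + T)) (fun t => f' (t + T))); auto.
  now apply has_deriv_shift.
Qed.

(** Otherwise the derivative would be negative just after the minimum. *)
Lemma second_deriv_at_min f f1 f2 m : has_deriv f f1 -> has_deriv f1 f2 ->
  (forall t, f m <= f t) -> f1 m = 0 /\ 0 <= f2 m.
Proof.
  intros H1 H2 Hm.
  assert (E : f1 m = 0).
  { assert (pr : derivable_pt f m) by (exists (f1 m); apply is_derive_Reals, H1).
    rewrite <- (is_derive_unique f m (f1 m) (H1 m)), <- (Derive_Reals f m pr).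
    apply (deriv_minimum f (m - 1) (m + 1)); intros; auto; lra. }
  split; auto.
  destruct (Rle_or_lt 0 (f2 m)) as [h|h]; auto. exfalso.
  assert (He : 0 < - f2 m / 2) by lra.
  destruct (proj1 (is_derive_Reals f1 m (f2 m)) (H2 m) _ He) as [d Hd].
  pose proof (cond_pos d).
  destruct (mean_value f f1 m (m + d / 2) H1) as [s [Hs1 Hs2]]; [lra|].
  assert (Hd' : Rabs ((f1 (m + (s - m)) - f1 m) / (s - m) - f2 m) < - f2 m / 2)
    by (apply Hd; [lra | rewrite Rabs_pos_eq; lra]).
  apply Rabs_def2 in Hd'. rewrite E in Hd'.
  replace (m + (s - m)) with s in Hd' by ring.
  assert (Hneg : f1 s < 0).
  { replace (f1 s) with ((f1 s - 0) / (s - m) * (s - m)) by (field; lra). nra. }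
  specialize (Hm (m + d / 2)). nra.
Qed.

(** * Wirtinger inequalities *)

(** The function [theta = k tan (k (t - mid))] solves [theta' = k^2 + theta^2] and is smooth on
    [[al, be]] because that interval is shorter than [PI / k].  Hence
    [v'^2 - k^2 v^2 = (v' + theta v)^2 - (theta v^2)'], and the last term integrates to zero. *)
Lemma Wirtinger_Dirichlet v v' k al be : has_deriv v v' -> cont v' -> v al = 0 -> v be = 0 ->
  al <= be -> 0 < k -> k * (be - al) < PI ->
  k ^ 2 * RInt (fun t => v t ^ 2) al be <= RInt (fun t => v' t ^ 2) al be.
Proof.
  intros Hv Hv' H0 H1 Hab Hk Hlen.
  set (mid := (al + be) / 2).
  set (theta := fun t => k * sin (k * (t - mid)) / cos (k * (t - mid))).
  assert (Hth : forall t, al <= t <= be -> is_derive theta t (k ^ 2 + theta t ^ 2)).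
  { intros t Ht.
    assert (Hc : 0 < cos (k * (t - mid))) by (apply cos_gt_0; unfold mid; nra).
    unfold theta. auto_derive; [now apply Rgt_not_eq|].
    unfold Rminus in *. field. lra. }
  set (df := fun t => (k ^ 2 + theta t ^ 2) * v t ^ 2 + theta t * (2 * v t * v' t)).
  assert (Hthc : forall t, al <= t <= be -> continuous theta t).
  { intros t Ht. apply (ex_derive_continuous theta t).
    exists (k ^ 2 + theta t ^ 2). now apply Hth. }
  assert (Hdfc : forall t, al <= t <= be -> continuous df t).
  { intros t Ht. unfold df.
    apply (continuous_plus (fun t => (k ^ 2 + theta t ^ 2) * v t ^ 2)
             (fun t => theta t * (2 * v t * v' t))).
    - apply (continuous_mult (fun t => k ^ 2 + theta t ^ 2) (fun t => v t ^ 2)).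
      + apply (continuous_plus (fun _ => k ^ 2) (fun t => theta t ^ 2)).
        * apply continuous_const.
        * apply (continuous_mult theta (fun t => theta t * 1)); auto.
          apply (continuous_mult theta (fun _ => 1)); auto. apply continuous_const.
      + apply (cont_pow v 2). solve_cont.
    - apply (continuous_mult theta (fun t => 2 * v t * v' t)); auto.
      revert t Ht. intros t _. revert t. change (cont (fun t => 2 * v t * v' t)). solve_cont. }
  assert (Hint : is_RInt df al be 0).
  { replace 0 with (minus (theta be * v be ^ 2) (theta al * v al ^ 2))
      by (rewrite H0, H1; unfold minus, plus, opp; simpl; ring).
    apply (is_RInt_derive (fun t => theta t * v t ^ 2) df);
      rewrite Rmin_left, Rmax_right by auto; auto.
    intros t Ht. unfold df.
    apply (is_derive_mult theta (fun t => v t ^ 2) t (k ^ 2 + theta t ^ 2) (2 * v t * v' t));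
      [now apply Hth | | intros; apply Rmult_comm].
    apply (is_derive_ext (fun t => v t * v t)); [intro; simpl; ring|].
    replace (2 * v t * v' t) with (v' t * v t + v t * v' t) by ring.
    now apply (has_deriv_mult v v' v v'). }
  assert (Hge : 0 <= RInt (fun t => (v' t ^ 2 - k ^ 2 * v t ^ 2) + df t) al be).
  { apply RInt_ge_0; auto.
    - apply (ex_RInt_plus (fun t => v' t ^ 2 - k ^ 2 * v t ^ 2) df).
      + apply ex_RInt_cont. solve_cont.
      + now exists 0.
    - intros t _. unfold df.
      replace (_ + _) with ((v' t + theta t * v t) ^ 2) by ring. apply pow2_ge_0. }
  assert (E : RInt (fun t => (v' t ^ 2 - k ^ 2 * v t ^ 2) + df t) al be
              = RInt (fun t => v' t ^ 2) al be - k ^ 2 * RInt (fun t => v t ^ 2) al be).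
  { rewrite <- RInt_cmul, <- RInt_sub by solve_cont.
    rewrite <- (Rplus_0_r (RInt (fun t => v' t ^ 2 - _) al be)).
    rewrite <- (is_RInt_unique df al be 0 Hint).
    apply (RInt_plus (fun t => v' t ^ 2 - k ^ 2 * v t ^ 2) df).
    - apply ex_RInt_cont. solve_cont.
    - now exists 0. }
  rewrite E in Hge. lra.
Qed.

(** By the intermediate value theorem [w] takes one value [m] at two points half a period apart;
    [w - m] then vanishes at the ends of two intervals of length [T / 2], and subtracting [m]
    only increases the square integral of a function of mean zero. *)
Lemma Wirtinger_periodic T w w' k : 0 < T -> has_deriv w w' -> cont w' -> periodic T w ->
  RInt w 0 T = 0 -> 0 < k -> k * T < 2 * PI ->
  k ^ 2 * RInt (fun t => w t ^ 2) 0 T <= RInt (fun t => w' t ^ 2) 0 T.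
Proof.
  intros HT Hw Hw' Hp Hm Hk HkT.
  assert (Hc : cont w) by solve_cont.
  assert (Hs : exists s, w (s + T / 2) = w s).
  { set (h := fun t => w (t + T / 2) - w t).
    assert (Hh : cont h) by (unfold h; solve_cont).
    assert (E : h (T / 2) = - h 0).
    { unfold h. replace (T / 2 + T / 2) with (0 + T) by field. rewrite Hp, Rplus_0_l. ring. }
    destruct (IVT_gen h 0 (T / 2) 0) as [s [_ Hs]].
    - intro t; apply continuity_pt_filterlim, Hh.
    - rewrite E. unfold Rmin, Rmax.
      destruct (Rle_dec (h 0) (- h 0)); lra.
    - exists s. unfold h in Hs. lra. }
  destruct Hs as [s Hs].
  set (v := fun t => w t - w s).
  assert (Hv : has_deriv v w').
  { apply (has_deriv_ext v (fun t => w' t - 0)); auto; [intro; ring|].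
    unfold v. apply has_deriv_minus; auto. apply has_deriv_const. }
  assert (Hvc : cont v) by solve_cont.
  pose proof (Wirtinger_Dirichlet v w' k s (s + T / 2) Hv Hw') as D1.
  pose proof (Wirtinger_Dirichlet v w' k (s + T / 2) (s + T) Hv Hw') as D2.
  specialize (D1 ltac:(unfold v; ring) ltac:(unfold v; rewrite Hs; ring) ltac:(lra) Hk ltac:(nra)).
  specialize (D2 ltac:(unfold v; rewrite Hs; ring) ltac:(unfold v; rewrite Hp; ring) ltac:(lra) Hk
                ltac:(nra)).
  assert (S : k ^ 2 * RInt (fun t => v t ^ 2) s (s + T) <= RInt (fun t => w' t ^ 2) s (s + T)).
  { rewrite (RInt_concat (fun t => v t ^ 2) s (s + T / 2) (s + T)) by solve_cont.
    rewrite (RInt_concat (fun t => w' t ^ 2) s (s + T / 2) (s + T)) by solve_cont. lra. }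
  rewrite (RInt_period T (fun t => v t ^ 2)), (RInt_period T (fun t => w' t ^ 2)) in S.
  - assert (E : RInt (fun t => v t ^ 2) 0 T = RInt (fun t => w t ^ 2) 0 T + T * w s ^ 2).
    { rewrite (RInt_same _ (fun t => w t ^ 2 + ((- (2 * w s)) * w t + w s ^ 2)))
        by (intro; unfold v; ring).
      rewrite RInt_add, RInt_add, RInt_cmul, RInt_cst, Hm by solve_cont. lra. }
    rewrite E in S.
    assert (0 <= k ^ 2 * (T * w s ^ 2)).
    { apply Rmult_le_pos; [apply pow2_ge_0|].
      apply Rmult_le_pos; [lra | apply pow2_ge_0]. }
    lra.
  - solve_cont.
  - intro t. now rewrite (periodic_deriv T w w' Hw Hp).
  - solve_cont.
  - intro t. unfold v. now rewrite Hp.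
Qed.

(** * Pointwise bounds by the energy *)

Lemma zero_of_mean_zero T w t : 0 < T -> cont w -> periodic T w -> RInt w 0 T = 0 ->
  exists s, t - T < s < t /\ w s = 0.
Proof.
  intros HT Hc Hp Hm.
  destruct (RInt_mean_value w (t - T) t Hc) as [s [H1 H2]]; [lra|].
  exists s; split; auto.
  replace (RInt w (t - T) t) with (RInt w (t - T) (t - T + T)) in H2 by (f_equal; ring).
  rewrite RInt_period, Hm in H2 by auto. nra.
Qed.

Lemma sup_le_energy T w w' : 0 < T -> has_deriv w w' -> cont w' -> periodic T w ->
  RInt w 0 T = 0 -> forall t, w t ^ 2 <= T * RInt (fun t => w' t ^ 2) 0 T.
Proof.
  intros HT Hw Hw' Hp Hm t.
  assert (Hc : cont w) by solve_cont.
  destruct (zero_of_mean_zero T w t HT Hc Hp Hm) as [s [Hs Hs0]].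
  pose proof (increment_sqr_le w w' s t ltac:(lra) Hw Hw') as H.
  rewrite Hs0, Rminus_0_r in H.
  assert (Hq : RInt (fun t => w' t ^ 2) s t <= RInt (fun t => w' t ^ 2) 0 T).
  { rewrite <- (RInt_period T (fun t => w' t ^ 2) (t - T)).
    - replace (t - T + T) with t by ring.
      rewrite (RInt_concat _ (t - T) s t) by solve_cont.
      pose proof (RInt_nonneg (fun t => w' t ^ 2) (t - T) s ltac:(lra) ltac:(solve_cont)
                    (fun x => pow2_ge_0 (w' x))). lra.
    - solve_cont.
    - intro x. now rewrite (periodic_deriv T w w' Hw Hp). }
  pose proof (RInt_nonneg (fun t => w' t ^ 2) s t ltac:(lra) ltac:(solve_cont)
                (fun x => pow2_ge_0 (w' x))). nra.
Qed.

Lemma sup_le_deriv T w w' B : 0 < T -> has_deriv w w' -> periodic T w ->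
  RInt w 0 T = 0 -> (forall t, Rabs (w' t) <= B) -> forall t, Rabs (w t) <= T * B.
Proof.
  intros HT Hw Hp Hm HB t.
  assert (Hc : cont w) by solve_cont.
  destruct (zero_of_mean_zero T w t HT Hc Hp Hm) as [s [Hs Hs0]].
  destruct (mean_value w w' s t Hw ltac:(lra)) as [r [Hr1 Hr2]].
  rewrite Hs0, Rminus_0_r in Hr2. rewrite Hr2, Rabs_mult, (Rabs_pos_eq (t - s)) by lra.
  specialize (HB r). pose proof (Rabs_pos (w' r)). nra.
Qed.

(** Between two points of the circle there are two arcs, of lengths [l1 + l2 = T]; the increment
    [d] satisfies [d^2 <= l_i E_i] on each, so [d^2 <= E l1 l2 / T <= E T / 4]. *)
Lemma oscillation_sqr_le T w w' : 0 < T -> has_deriv w w' -> cont w' -> periodic T w ->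
  forall x y, 4 * (w x - w y) ^ 2 <= T * RInt (fun t => w' t ^ 2) 0 T.
Proof.
  intros HT Hw Hw' Hp x y.
  destruct (period_window T x y HT) as [x' [[H1 H2] H3]].
  rewrite <- (H3 w Hp).
  pose proof (increment_sqr_le w w' y x' ltac:(lra) Hw Hw') as I1.
  pose proof (increment_sqr_le w w' x' (y + T) ltac:(lra) Hw Hw') as I2.
  rewrite Hp in I2.
  rewrite <- (RInt_period T (fun t => w' t ^ 2) y).
  - rewrite (RInt_concat _ y x' (y + T)) by solve_cont.
    pose proof (RInt_nonneg (fun t => w' t ^ 2) y x' ltac:(lra) ltac:(solve_cont)
                  (fun z => pow2_ge_0 (w' z))) as P1.
    pose proof (RInt_nonneg (fun t => w' t ^ 2) x' (y + T) ltac:(lra) ltac:(solve_cont)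
                  (fun z => pow2_ge_0 (w' z))) as P2.
    set (A := RInt (fun t => w' t ^ 2) y x') in *.
    set (B := RInt (fun t => w' t ^ 2) x' (y + T)) in *.
    replace ((w y - w x') ^ 2) with ((w x' - w y) ^ 2) in I2 by ring.
    set (d := (w x' - w y) ^ 2) in *.
    assert (Hd : 0 <= d) by apply pow2_ge_0.
    set (p := x' - y) in *. replace (y + T - x') with (T - p) in I2 by (unfold p; ring).
    assert (Hp' : 0 <= p < T) by (unfold p; lra).
    (* each arc estimate is weighted by the length of the other arc *)
    assert (J : T * d <= p * (T - p) * (A + B)).
    { assert ((T - p) * d <= (T - p) * (p * A)) by (apply Rmult_le_compat_l; lra).
      assert (p * d <= p * ((T - p) * B)) by (apply Rmult_le_compat_l; lra). nra. }
    assert (J2 : p * (T - p) * (A + B) <= T ^ 2 / 4 * (A + B)).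
    { apply Rmult_le_compat_r; [lra|]. pose proof (pow2_ge_0 (T - 2 * p)). nra. }
    apply Rmult_le_reg_l with T; auto. nra.
  - solve_cont.
  - intro z. now rewrite (periodic_deriv T w w' Hw Hp).
Qed.

(** * Energy estimates below the first eigenvalue *)

(** The strict gap leaves room for a frequency [k] below the critical one, so that the tangent in
    the proof of [Wirtinger_Dirichlet] stays bounded on half a period. *)
Lemma subcritical_frequency T M : 0 < T -> 0 <= M -> M < (2 * PI / T) ^ 2 ->
  exists k, 0 < k /\ M < k ^ 2 /\ k * T < 2 * PI.
Proof.
  intros HT HM H. pose proof PI_RGT_0.
  assert (Hw : 0 < 2 * PI / T) by (apply Rdiv_lt_0_compat; lra).
  set (om := 2 * PI / T) in *.
  assert (E : om * T = 2 * PI) by (unfold om; field; lra).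
  assert (Hs : 0 < (M + om ^ 2) / 2) by nra.
  exists (sqrt ((M + om ^ 2) / 2)). repeat split.
  - now apply sqrt_lt_R0.
  - rewrite pow2_sqrt by lra. lra.
  - rewrite <- E. apply Rmult_lt_compat_r; auto.
    apply Rlt_le_trans with (sqrt (om ^ 2)).
    + apply sqrt_lt_1; lra.
    + rewrite sqrt_pow2; lra.
Qed.

Lemma subcritical_Wirtinger T M : 0 < T -> 0 <= M -> M < (2 * PI / T) ^ 2 ->
  exists kap, 0 <= kap < 1 /\ forall w w', has_deriv w w' -> cont w' -> periodic T w ->
    RInt w 0 T = 0 ->
    M * RInt (fun t => w t ^ 2) 0 T <= kap * RInt (fun t => w' t ^ 2) 0 T.
Proof.
  intros HT HM H. destruct (subcritical_frequency T M HT HM H) as [k [Hk [Hk1 Hk2]]].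
  exists (M / k ^ 2).
  assert (Hk3 : 0 < k ^ 2) by (apply pow_lt; auto).
  repeat split.
  - apply Rmult_le_pos; auto. left; now apply Rinv_0_lt_compat.
  - apply Rmult_lt_reg_r with (k ^ 2); auto. unfold Rdiv.
    rewrite Rmult_assoc, Rinv_l; lra.
  - intros w w' Hw Hw' Hp Hm.
    pose proof (Wirtinger_periodic T w w' k HT Hw Hw' Hp Hm Hk Hk2) as W.
    replace (M * RInt (fun t => w t ^ 2) 0 T)
      with (M / k ^ 2 * (k ^ 2 * RInt (fun t => w t ^ 2) 0 T)) by (field; lra).
    apply Rmult_le_compat_l; auto.
    apply Rmult_le_pos; auto. left; now apply Rinv_0_lt_compat.
Qed.

(** The test function [w] itself: the damping term integrates to zero by periodicity, the constant
    [m] because [w] has mean zero. *)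
Lemma energy_identity T c w w1 w2 f m : has_deriv w w1 -> has_deriv w1 w2 ->
  cont w2 -> cont f -> periodic T w -> RInt w 0 T = 0 ->
  (forall t, w2 t + c * w1 t + f t = m) ->
  RInt (fun t => w1 t ^ 2) 0 T = RInt (fun t => f t * w t) 0 T.
Proof.
  intros H1 H2 Hc2 Hcf Hp Hm Heq.
  assert (Hc : cont w) by solve_cont. assert (Hc1 : cont w1) by solve_cont.
  pose proof (RInt_deriv _ _ 0 T (has_deriv_mult w w1 w1 w2 H1 H2) ltac:(solve_cont)) as I1.
  pose proof (RInt_deriv _ _ 0 T (has_deriv_mult w w1 w w1 H1 H1) ltac:(solve_cont)) as I2.
  cbv beta in I1, I2.
  pose proof (Hp 0) as P0. pose proof (periodic_deriv T w w1 H1 Hp 0) as P1.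
  rewrite Rplus_0_l in P0, P1. rewrite P0, P1 in I1. rewrite P0 in I2.
  rewrite (RInt_same (fun t => w1 t * w1 t + w t * w2 t)
    (fun t => w1 t ^ 2 + (m * w t - ((c / 2) * (w1 t * w t + w t * w1 t) + f t * w t)))) in I1
    by (intro t; rewrite <- (Heq t); field).
  rewrite RInt_add, RInt_sub, RInt_add, RInt_cmul, RInt_cmul, I2, Hm in I1 by solve_cont.
  lra.
Qed.

(** The coercivity behind uniqueness, continuity and linearization: the quadratic part of [f w]
    stays below the first eigenvalue and is absorbed by the Wirtinger inequality, so that [w] is
    controlled by the remaining error [B]. *)
Lemma coercivity T M : 0 < T -> 0 <= M -> M < (2 * PI / T) ^ 2 ->
  exists A, 0 < A /\ forall c w w1 w2 f m B, has_deriv w w1 -> has_deriv w1 w2 ->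
    cont w2 -> cont f -> periodic T w -> RInt w 0 T = 0 ->
    (forall t, w2 t + c * w1 t + f t = m) ->
    (forall t, f t * w t <= M * w t ^ 2 + B) -> forall t, w t ^ 2 <= A * B.
Proof.
  intros HT HM H. destruct (subcritical_Wirtinger T M HT HM H) as [kap [Hk HW]].
  exists (T * (T / (1 - kap))). split.
  { apply Rmult_lt_0_compat; auto. apply Rdiv_lt_0_compat; lra. }
  intros c w w1 w2 f m B H1 H2 Hc2 Hcf Hp Hm Heq HB t.
  assert (Hc : cont w) by solve_cont. assert (Hc1 : cont w1) by solve_cont.
  eapply Rle_trans; [now apply (sup_le_energy T w w1)|].
  rewrite Rmult_assoc. apply Rmult_le_compat_l; [lra|].
  pose proof (energy_identity T c w w1 w2 f m H1 H2 Hc2 Hcf Hp Hm Heq) as E.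
  assert (I : RInt (fun t => f t * w t) 0 T <= RInt (fun t => M * w t ^ 2 + B) 0 T)
    by (apply RInt_mono; [lra | solve_cont | solve_cont | auto]).
  rewrite RInt_add, RInt_cmul, RInt_cst in I by solve_cont.
  pose proof (HW w w1 H1 Hc1 Hp Hm) as W.
  set (Q := RInt (fun t => w1 t ^ 2) 0 T) in *.
  assert (Q * (1 - kap) <= T * B) by lra.
  apply Rmult_le_reg_r with (1 - kap); [lra|].
  replace (T / (1 - kap) * B * (1 - kap)) with (T * B) by (field; lra). auto.
Qed.

(** * Positivity of periodic solutions of the linearized equation *)

(** Gronwall for [z^2 + z'^2]. *)
Lemma linear_ode_unique c Q0 q z z1 z2 r : has_deriv z z1 -> has_deriv z1 z2 ->
  (forall t, Rabs (q t) <= Q0) -> (forall t, z2 t + c * z1 t + q t * z t = 0) ->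
  z r = 0 -> z1 r = 0 -> forall t, r <= t -> z t = 0.
Proof.
  intros H1 H2 Hq Heq Hr Hr1 t Ht.
  set (K := 1 + 2 * Rabs c + Q0).
  set (E := fun t => z t * z t + z1 t * z1 t).
  set (E' := fun t => (z1 t * z t + z t * z1 t) + (z2 t * z1 t + z1 t * z2 t)).
  assert (HE : has_deriv E E') by (apply has_deriv_plus; now apply has_deriv_mult).
  assert (HX : has_deriv (fun t => exp (- K * t)) (fun t => - K * exp (- K * t))).
  { intro x. auto_derive; auto. ring. }
  pose proof (has_deriv_mult _ _ _ _ HE HX) as HF.
  assert (HEK : forall t, E' t <= K * E t).
  { intro x. unfold E', E, K.
    replace (z2 x) with (- c * z1 x - q x * z x) by (specialize (Heq x); lra).
    pose proof (Rle_abs (- c)) as C1. rewrite Rabs_Ropp in C1.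
    pose proof (Hq x) as C2. apply Rabs_le_between in C2.
    assert (- (2 * c * z1 x ^ 2) <= 2 * Rabs c * z1 x ^ 2)
      by (pose proof (pow2_ge_0 (z1 x)); nra).
    assert (2 * (1 - q x) * (z x * z1 x) <= (1 + Q0) * (z x ^ 2 + z1 x ^ 2)).
    { pose proof (pow2_ge_0 (z x - z1 x)). pose proof (pow2_ge_0 (z x + z1 x)).
      nra. }
    assert (0 <= 2 * Rabs c * z x ^ 2)
      by (pose proof (pow2_ge_0 (z x)); pose proof (Rabs_pos c); nra).
    nra. }
  assert (Hz : E t <= 0).
  { destruct (Req_dec r t) as [<-|Hne].
    { unfold E. rewrite Hr, Hr1. lra. }
    destruct (mean_value _ _ r t HF ltac:(lra)) as [s [Hs1 Hs2]].
    cbv beta in Hs2.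
    assert (E0 : E r = 0) by (unfold E; rewrite Hr, Hr1; ring).
    rewrite E0, Rmult_0_l, Rminus_0_r in Hs2.
    pose proof (exp_pos (- K * s)) as X1. pose proof (exp_pos (- K * t)) as X2.
    specialize (HEK s).
    assert (E' s * exp (- K * s) + E s * (- K * exp (- K * s)) <= 0) by nra.
    assert (E t * exp (- K * t) <= 0) by nra. nra. }
  unfold E in Hz. nra.
Qed.

(** A nodal arc of length at most [T / 2] would contradict the Dirichlet form of Wirtinger's
    inequality unless the solution vanishes on it. *)
Lemma short_nodal_arc T c M q z z1 z2 al be : 0 < T -> 0 <= M -> M < (2 * PI / T) ^ 2 ->
  has_deriv z z1 -> has_deriv z1 z2 -> cont z2 -> cont q -> (forall t, q t <= M) ->
  (forall t, z2 t + c * z1 t + q t * z t = 0) ->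
  al < be -> be - al <= T / 2 -> z al = 0 -> z be = 0 ->
  exists r, al < r < be /\ z r = 0 /\ z1 r = 0.
Proof.
  intros HT HM H H1 H2 Hc2 Hcq HqM Heq Hab Hlen Ha Hb.
  assert (Hc : cont z) by solve_cont. assert (Hc1 : cont z1) by solve_cont.
  destruct (subcritical_frequency T M HT HM H) as [k [Hk [Hk1 Hk2]]].
  pose proof (Wirtinger_Dirichlet z z1 k al be H1 Hc1 Ha Hb ltac:(lra) Hk ltac:(nra)) as W.
  pose proof (RInt_deriv _ _ al be (has_deriv_mult z z1 z1 z2 H1 H2) ltac:(solve_cont)) as I1.
  pose proof (RInt_deriv _ _ al be (has_deriv_mult z z1 z z1 H1 H1) ltac:(solve_cont)) as I2.
  cbv beta in I1, I2.
  rewrite Ha, Hb in I1, I2.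
  rewrite (RInt_same (fun t => z1 t * z1 t + z t * z2 t)
    (fun t => z1 t ^ 2 - ((c / 2) * (z1 t * z t + z t * z1 t) + q t * z t ^ 2))) in I1
    by (intro t; replace (z2 t) with (- c * z1 t - q t * z t)
          by (specialize (Heq t); lra); field).
  rewrite RInt_sub, RInt_add, RInt_cmul, I2 in I1 by solve_cont.
  assert (I : RInt (fun t => q t * z t ^ 2) al be <= RInt (fun t => M * z t ^ 2) al be).
  { apply RInt_mono; [lra | solve_cont | solve_cont |].
    intro t. apply Rmult_le_compat_r; [apply pow2_ge_0 | auto]. }
  rewrite RInt_cmul in I by solve_cont.
  pose proof (RInt_nonneg (fun t => z t ^ 2) al be ltac:(lra) ltac:(solve_cont)
                (fun x => pow2_ge_0 (z x))) as N0.
  pose proof (RInt_nonneg (fun t => z1 t ^ 2) al be ltac:(lra) ltac:(solve_cont)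
                (fun x => pow2_ge_0 (z1 x))) as N1.
  destruct (RInt_mean_value (fun t => z t ^ 2 + z1 t ^ 2) al be ltac:(solve_cont) Hab)
    as [r [Hr1 Hr2]].
  cbv beta in Hr2.
  rewrite RInt_add in Hr2 by solve_cont.
  set (Z := RInt (fun t => z t ^ 2) al be) in *.
  set (Z1 := RInt (fun t => z1 t ^ 2) al be) in *.
  assert (Z = 0) by nra. assert (Z1 = 0) by nra.
  exists r. split; auto.
  assert (S : z r ^ 2 + z1 r ^ 2 = 0) by nra.
  pose proof (pow2_ge_0 (z r)). pose proof (pow2_ge_0 (z1 r)).
  split; apply Rsqr_0_uniq; unfold Rsqr; nra.
Qed.

Lemma IVT_zero f a b : cont f -> a < b -> f a * f b < 0 -> exists s, a < s < b /\ f s = 0.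
Proof.
  intros Hf Hab Hs.
  destruct (IVT_gen f a b 0) as [s [H1 H2]].
  - intro t; apply continuity_pt_filterlim, Hf.
  - unfold Rmin, Rmax. destruct (Rle_dec (f a) (f b)); split; nra.
  - rewrite Rmin_left, Rmax_right in H1 by lra. exists s; split; auto.
    destruct (Req_dec s a) as [->|]; [rewrite H2 in Hs; lra|].
    destruct (Req_dec s b) as [->|]; [rewrite H2 in Hs; lra|]. lra.
Qed.

(** A sign change would create two nodal arcs covering a period, one of them of length at most
    [T / 2]; touching zero without changing sign is a double zero. Either way the solution
    would vanish identically. *)
Lemma kernel_positive T c M Q0 q z z1 z2 : 0 < T -> 0 <= M -> M < (2 * PI / T) ^ 2 ->
  has_deriv z z1 -> has_deriv z1 z2 -> cont z2 -> cont q -> (forall t, q t <= M) ->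
  (forall t, Rabs (q t) <= Q0) ->
  (forall t, z2 t + c * z1 t + q t * z t = 0) -> periodic T z -> 0 < RInt z 0 T ->
  forall t, 0 < z t.
Proof.
  intros HT HM H H1 H2 Hc2 Hcq HqM HqQ Heq Hp Hm.
  assert (Hc : cont z) by solve_cont.
  assert (Hno : forall r, z r = 0 -> z1 r = 0 -> False).
  { intros r Hr Hr1.
    destruct (RInt_mean_value z r (r + T) Hc ltac:(lra)) as [s [Hs1 Hs2]].
    rewrite (linear_ode_unique c Q0 q z z1 z2 r H1 H2 HqQ Heq Hr Hr1 s) in Hs2 by lra.
    rewrite RInt_period in Hs2 by auto. lra. }
  destruct (periodic_min T z HT Hc Hp) as [s Hs].
  destruct (second_deriv_at_min z z1 z2 s H1 H2 Hs) as [Hs1 _].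
  assert (Hpos : 0 < z s).
  { destruct (Rtotal_order (z s) 0) as [h|[h|h]]; auto; exfalso.
    - destruct (RInt_mean_value z s (s + T) Hc ltac:(lra)) as [p [Hp1 Hp2]].
      rewrite RInt_period in Hp2 by auto.
      assert (Hzp : 0 < z p) by nra.
      destruct (IVT_zero z s p Hc ltac:(lra) ltac:(nra)) as [al [Ha1 Ha2]].
      destruct (IVT_zero z p (s + T) Hc ltac:(lra)) as [be [Hb1 Hb2]].
      { rewrite Hp. nra. }
      destruct (Rle_or_lt (be - al) (T / 2)) as [h'|h'].
      + destruct (short_nodal_arc T c M q z z1 z2 al be) as [r [_ [R1 R2]]]; auto; try lra.
        now apply (Hno r).
      + destruct (short_nodal_arc T c M q z z1 z2 be (al + T)) as [r [_ [R1 R2]]];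
          auto; try lra.
        * now rewrite Hp.
        * now apply (Hno r).
    - now apply (Hno s). }
  intro t. specialize (Hs t). lra.
Qed.

(** * Existence below the first eigenvalue *)

Definition mean_free (T : R) (w : R -> R) : Prop :=
  cont w /\ periodic T w /\ RInt w 0 T = 0.

(** Inverts differentiation on mean-free functions. *)
Definition prim (T : R) (f : R -> R) (t : R) : R :=
  RInt f 0 t - average T (fun s => RInt f 0 s).

Definition center (T : R) (f : R -> R) (t : R) : R := f t - average T f.

Lemma RInt_average T f : T <> 0 -> RInt f 0 T = T * average T f.
Proof.
  intros HT; unfold average. rewrite <- Rmult_assoc.
  replace (T * (1 / T)) with 1 by (field; auto). now rewrite Rmult_1_l.
Qed.

Lemma average_diff_le T f g B : 0 < T -> cont f -> cont g ->
  (forall t, Rabs (f t - g t) <= B) -> Rabs (average T f - average T g) <= B.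
Proof.
  intros HT Hf Hg HB.
  assert (E : RInt (fun t => f t - g t) 0 T = T * (average T f - average T g))
    by (rewrite RInt_sub, !RInt_average by (auto; lra); lra).
  assert (U : RInt (fun t => f t - g t) 0 T <= RInt (fun _ => B) 0 T).
  { apply RInt_mono; [lra | solve_cont | solve_cont |].
    intro t; specialize (HB t); apply Rabs_le_between in HB; lra. }
  assert (D : RInt (fun _ => - B) 0 T <= RInt (fun t => f t - g t) 0 T).
  { apply RInt_mono; [lra | solve_cont | solve_cont |].
    intro t; specialize (HB t); apply Rabs_le_between in HB; lra. }
  rewrite RInt_cst in U, D. rewrite E in U, D. apply Rabs_le. split; nra.
Qed.

Lemma center_mean_free T f : 0 < T -> cont f -> periodic T f -> mean_free T (center T f).
Proof.
  intros HT Hf Hp. unfold center. repeat split.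
  - solve_cont.
  - intro t. now rewrite Hp.
  - rewrite RInt_sub, RInt_cst, RInt_average by (try solve_cont; lra). lra.
Qed.

Lemma prim_deriv T f : cont f -> has_deriv (prim T f) f.
Proof.
  intros Hf. apply (has_deriv_ext (prim T f) (fun t => f t - 0)); auto; [intro; ring|].
  apply has_deriv_minus; [now apply has_deriv_RInt | apply has_deriv_const].
Qed.

Lemma prim_mean_free T f : 0 < T -> mean_free T f -> mean_free T (prim T f).
Proof.
  intros HT [Hf [Hp Hm]].
  pose proof (has_deriv_RInt f 0 Hf) as Hd.
  apply (center_mean_free T (fun s => RInt f 0 s)); auto.
  - solve_cont.
  - intro t. rewrite (RInt_concat f 0 t (t + T)), RInt_period, Hm by auto. lra.
Qed.

Lemma mean_free_add T f g : mean_free T f -> mean_free T g -> mean_free T (fun t => f t + g t).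
Proof.
  intros [Hf [Hp Hm]] [Hf' [Hp' Hm']]. repeat split.
  - solve_cont.
  - intro t. now rewrite Hp, Hp'.
  - rewrite RInt_add, Hm, Hm' by auto. lra.
Qed.

Lemma mean_free_scal T k f : mean_free T f -> mean_free T (fun t => k * f t).
Proof.
  intros [Hf [Hp Hm]]. repeat split.
  - solve_cont.
  - intro t. now rewrite Hp.
  - rewrite RInt_cmul, Hm by auto. lra.
Qed.

Lemma mean_free_sub T f g : mean_free T f -> mean_free T g -> mean_free T (fun t => f t - g t).
Proof.
  intros [Hf [Hp Hm]] [Hf' [Hp' Hm']]. repeat split.
  - solve_cont.
  - intro t. now rewrite Hp, Hp'.
  - rewrite RInt_sub, Hm, Hm' by auto. lra.
Qed.

Lemma prim_diff_le T f g B : 0 < T -> mean_free T f -> mean_free T g ->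
  (forall t, Rabs (f t - g t) <= B) -> forall t, Rabs (prim T f t - prim T g t) <= T * B.
Proof.
  intros HT Hf Hg HB.
  destruct (mean_free_sub T _ _ (prim_mean_free T f HT Hf) (prim_mean_free T g HT Hg))
    as [_ [Hp Hm]].
  apply (sup_le_deriv T (fun t => prim T f t - prim T g t) (fun t => f t - g t)); auto.
  apply has_deriv_minus; apply prim_deriv; [apply Hf | apply Hg].
Qed.

Lemma center_diff_le T f g B : 0 < T -> cont f -> cont g ->
  (forall t, Rabs (f t - g t) <= B) -> forall t, Rabs (center T f t - center T g t) <= 2 * B.
Proof.
  intros HT Hf Hg HB t. unfold center.
  pose proof (average_diff_le T f g B HT Hf Hg HB) as H. specialize (HB t).
  apply Rabs_le_between in H, HB. apply Rabs_le. lra.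
Qed.

(** Only the one-sided constant [M] in [adm_mono] is compared with the spectrum; [L] may be much
    larger, because the truncated singular force decreases steeply. *)
Record admissible (T L M : R) (N : R -> R -> R) : Prop := {
  adm_cont : forall u, cont u -> cont (fun t => N t (u t));
  adm_per : forall t x, N (t + T) x = N t x;
  adm_lip : forall t x y, Rabs (N t x - N t y) <= L * Rabs (x - y);
  adm_mono : forall t x y, (N t x - N t y) * (x - y) <= M * (x - y) ^ 2 }.

Definition forcing (T : R) (N : R -> R -> R) (u : R -> R) : R -> R :=
  center T (fun t => N t (u t)).

(** Integrating [U'' + c U' + N (t, U) = const] twice turns it into [residual U = 0]. *)
Definition residual (T c : R) (N : R -> R -> R) (u : R -> R) (t : R) : R :=
  u t + c * prim T u t + prim T (prim T (forcing T N u)) t.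

Definition residual_deriv (T c : R) (N : R -> R -> R) (u u1 : R -> R) (t : R) : R :=
  u1 t + c * u t + prim T (forcing T N u) t.

Lemma forcing_mean_free T L M N u : 0 < T -> admissible T L M N -> mean_free T u ->
  mean_free T (forcing T N u).
Proof.
  intros HT HN [Hc [Hp Hm]]. apply center_mean_free; auto.
  - now apply (adm_cont T L M).
  - intro t. rewrite Hp. apply (adm_per T L M N HN).
Qed.

Lemma forcing_diff_le T L M N u v S : 0 < T -> 0 <= L -> admissible T L M N ->
  mean_free T u -> mean_free T v -> (forall t, Rabs (u t - v t) <= S) ->
  forall t, Rabs (forcing T N u t - forcing T N v t) <= 2 * (L * S).
Proof.
  intros HT HL HN Hu Hv HS. apply center_diff_le; auto.
  - apply (adm_cont T L M N HN); apply Hu.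
  - apply (adm_cont T L M N HN); apply Hv.
  - intro t. eapply Rle_trans; [apply (adm_lip T L M N HN)|].
    apply Rmult_le_compat_l; auto.
Qed.

Lemma residual_mean_free T c L M N u : 0 < T -> admissible T L M N -> mean_free T u ->
  mean_free T (residual T c N u).
Proof.
  intros HT HN Hu. unfold residual.
  assert (HF := forcing_mean_free T L M N u HT HN Hu).
  apply mean_free_add; [apply mean_free_add|]; auto.
  - now apply mean_free_scal, prim_mean_free.
  - now apply prim_mean_free, prim_mean_free.
Qed.

Lemma residual_has_deriv T c L M N u u1 : 0 < T -> admissible T L M N -> mean_free T u ->
  has_deriv u u1 -> has_deriv (residual T c N u) (residual_deriv T c N u u1).
Proof.
  intros HT HN Hu Hd. unfold residual, residual_deriv.
  assert (HF := forcing_mean_free T L M N u HT HN Hu).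
  apply has_deriv_plus; [apply has_deriv_plus|]; auto.
  - apply has_deriv_scal, prim_deriv, Hu.
  - apply prim_deriv, prim_mean_free; auto.
Qed.

Lemma residual_lipschitz T c L M N u v S : 0 < T -> 0 <= L -> admissible T L M N ->
  mean_free T u -> mean_free T v -> (forall t, Rabs (u t - v t) <= S) ->
  forall t, Rabs (residual T c N u t - residual T c N v t)
            <= (1 + Rabs c * T + 2 * L * T ^ 2) * S.
Proof.
  intros HT HL HN Hu Hv HS t.
  assert (Fu := forcing_mean_free T L M N u HT HN Hu).
  assert (Fv := forcing_mean_free T L M N v HT HN Hv).
  pose proof (prim_diff_le T u v S HT Hu Hv HS t) as P1.
  pose proof (prim_diff_le T _ _ _ HT (prim_mean_free T _ HT Fu) (prim_mean_free T _ HT Fv)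
    (prim_diff_le T _ _ _ HT Fu Fv (forcing_diff_le T L M N u v S HT HL HN Hu Hv HS)) t) as P2.
  specialize (HS t). unfold residual.
  replace (_ - _) with ((u t - v t) + c * (prim T u t - prim T v t)
    + (prim T (prim T (forcing T N u)) t - prim T (prim T (forcing T N v)) t)) by ring.
  eapply Rle_trans; [apply Rabs_triang|].
  eapply Rle_trans; [apply Rplus_le_compat_r, Rabs_triang|].
  rewrite Rabs_mult. pose proof (Rabs_pos c). nra.
Qed.

Definition step (T c tau : R) (N : R -> R -> R) (u : R -> R) (t : R) : R :=
  u t - tau * residual T c N u t.

Definition step_deriv (T c tau : R) (N : R -> R -> R) (u u1 : R -> R) (t : R) : R :=
  u1 t - tau * residual_deriv T c N u u1 t.

(** Zarantonello's argument: in the inner product [int u' v'] the map [residual] is Lipschitz, and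
    strongly monotone because the damping term is skew and [N] grows less than the first
    eigenvalue. Hence a small step against it is a contraction. *)
Lemma step_contracts T c L M N : 0 < T -> 0 <= L -> 0 <= M -> M < (2 * PI / T) ^ 2 ->
  admissible T L M N ->
  exists tau q, 0 < tau /\ 0 <= q < 1 /\
  forall u u1 v v1, mean_free T u -> mean_free T v -> has_deriv u u1 -> has_deriv v v1 ->
    cont u1 -> cont v1 ->
    RInt (fun t => (step_deriv T c tau N u u1 t - step_deriv T c tau N v v1 t) ^ 2) 0 T
    <= q * RInt (fun t => (u1 t - v1 t) ^ 2) 0 T.
Proof.
  intros HT HL HM HMw HN.
  destruct (subcritical_Wirtinger T M HT HM HMw) as [kap [Hk HW]].
  set (B := 3 * (1 + c ^ 2 * T ^ 2 + 4 * L ^ 2 * T ^ 4)).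
  assert (HB : 3 <= B).
  { unfold B. assert (0 <= c ^ 2 * T ^ 2) by (rewrite <- Rpow_mult_distr; apply pow2_ge_0).
    assert (0 <= L ^ 2 * T ^ 4).
    { replace (L ^ 2 * T ^ 4) with ((L * T ^ 2) ^ 2) by ring. apply pow2_ge_0. }
    lra. }
  exists ((1 - kap) / B), (1 - (1 - kap) ^ 2 / B).
  assert (Hx : (1 - kap) ^ 2 / B <= 1).
  { apply Rmult_le_reg_r with B; [lra|]. unfold Rdiv. rewrite Rmult_assoc, Rinv_l by lra. nra. }
  assert (Hx' : 0 < (1 - kap) ^ 2 / B).
  { apply Rdiv_lt_0_compat; [|lra]. apply pow_lt. lra. }
  split; [apply Rdiv_lt_0_compat; lra|]. split; [lra|].
  intros u u1 v v1 Hu Hv Hdu Hdv Hcu Hcv.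
  set (tau := (1 - kap) / B).
  pose proof (mean_free_sub T u v Hu Hv) as Hw.
  assert (Fu := forcing_mean_free T L M N u HT HN Hu).
  assert (Fv := forcing_mean_free T L M N v HT HN Hv).
  pose proof (mean_free_sub T _ _ Fu Fv) as HF.
  pose proof (prim_deriv T _ (proj1 Fu)) as Pu. pose proof (prim_deriv T _ (proj1 Fv)) as Pv.
  set (fu := forcing T N u) in *. set (fv := forcing T N v) in *.
  assert (Hcfu : cont fu) by apply Fu. assert (Hcfv : cont fv) by apply Fv.
  pose proof (mean_free_sub T _ _ (prim_mean_free T _ HT Fu) (prim_mean_free T _ HT Fv)) as HH.
  set (w := fun t => u t - v t) in *.
  set (w1 := fun t => u1 t - v1 t).
  set (h := fun t => prim T fu t - prim T fv t) in *.
  set (f := fun t => fu t - fv t) in *.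
  assert (Hdw : has_deriv w w1) by now apply has_deriv_minus.
  assert (Hdh : has_deriv h f) by now apply has_deriv_minus.
  assert (Cw1 : cont w1) by (unfold w1; solve_cont).
  assert (Cf : cont f) by (unfold f; solve_cont).
  assert (Cw : cont w) by apply Hw. assert (Ch : cont h) by apply HH.
  set (g := fun t => w1 t + c * w t + h t).
  assert (Cg : cont g) by (unfold g; solve_cont).
  rewrite (RInt_same (fun t => (step_deriv _ _ _ _ u u1 t - _) ^ 2)
    (fun t => w1 t ^ 2 + ((- 2 * tau) * (w1 t * g t) + tau ^ 2 * g t ^ 2)))
    by (intro t; unfold step_deriv, residual_deriv, g, w1, w, h, fu, fv; ring).
  change (RInt (fun t => (u1 t - v1 t) ^ 2) 0 T) with (RInt (fun t => w1 t ^ 2) 0 T).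
  rewrite RInt_add, RInt_add, RInt_cmul, RInt_cmul by solve_cont.
  set (Q := RInt (fun t => w1 t ^ 2) 0 T).
  assert (HQ : 0 <= Q) by (apply RInt_nonneg; [lra | solve_cont | intro; apply pow2_ge_0]).
  assert (Sup : forall t, w t ^ 2 <= T * Q) by (apply sup_le_energy; auto; apply Hw).
  (* integrate by parts: int w' w = 0 and int w' h = - int w f *)
  assert (Mono : (1 - kap) * Q <= RInt (fun t => w1 t * g t) 0 T).
  { assert (Hpw : w T = w 0) by (rewrite <- (Rplus_0_l T); apply Hw).
    assert (Hph : h T = h 0) by (rewrite <- (Rplus_0_l T); apply HH).
    pose proof (RInt_deriv _ _ 0 T (has_deriv_mult w w1 w w1 Hdw Hdw) ltac:(solve_cont)) as I1.
    pose proof (RInt_deriv _ _ 0 T (has_deriv_mult w w1 h f Hdw Hdh) ltac:(solve_cont)) as I2.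
    cbv beta in I1, I2. rewrite Hpw in I1. rewrite Hpw, Hph in I2.
    rewrite (RInt_same (fun t => w1 t * g t) (fun t => w1 t ^ 2 + ((c / 2)
      * (w1 t * w t + w t * w1 t) + ((w1 t * h t + w t * f t) - w t * f t))))
      by (intro t; unfold g; field).
    rewrite RInt_add, RInt_add, RInt_sub, RInt_cmul, I1, I2 by solve_cont. fold Q.
    assert (J : RInt (fun t => w t * f t) 0 T <= kap * Q).
    { set (k := average T (fun t => N t (u t)) - average T (fun t => N t (v t))).
      assert (J1 : RInt (fun t => w t * f t) 0 T
                   <= RInt (fun t => M * w t ^ 2 - k * w t) 0 T).
      { apply RInt_mono; [lra | solve_cont | solve_cont |].
        intro t. pose proof (adm_mono T L M N HN t (u t) (v t)) as A.
        unfold f, fu, fv, forcing, center, w, k. nra. }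
      rewrite RInt_sub, !RInt_cmul, (proj2 (proj2 Hw)) in J1 by solve_cont.
      pose proof (HW w w1 Hdw Cw1 (proj1 (proj2 Hw)) (proj2 (proj2 Hw))). fold Q in H. lra. }
    lra. }
  (* (x + y + z)^2 <= 3 (x^2 + y^2 + z^2), the last two terms being bounded through sup |w| *)
  assert (Lip : RInt (fun t => g t ^ 2) 0 T <= B * Q).
  { set (S := sqrt (T * Q)).
    assert (HTQ : 0 <= T * Q) by (apply Rmult_le_pos; lra).
    assert (HS : 0 <= S) by apply sqrt_pos.
    assert (HS2 : S ^ 2 = T * Q) by (apply pow2_sqrt; auto).
    assert (HwS : forall t, Rabs (w t) <= S).
    { intro t. rewrite <- (Rabs_pos_eq S) by auto. apply Rsqr_le_abs_0.
      specialize (Sup t). unfold Rsqr. nra. }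
    assert (HhS : forall t, Rabs (h t) <= T * (2 * (L * S))).
    { apply prim_diff_le; auto. now apply (forcing_diff_le T L M). }
    assert (J : RInt (fun t => g t ^ 2) 0 T <= RInt (fun t => 3 * w1 t ^ 2
              + 3 * (c ^ 2 * (T * Q) + 4 * T ^ 2 * L ^ 2 * (T * Q))) 0 T).
    { apply RInt_mono; [lra | solve_cont | solve_cont |]. intro t.
      assert (h t ^ 2 <= 4 * T ^ 2 * L ^ 2 * (T * Q)).
      { rewrite <- HS2, <- (pow2_abs (h t)). specialize (HhS t).
        pose proof (Rabs_pos (h t)).
        replace (4 * T ^ 2 * L ^ 2 * S ^ 2) with ((T * (2 * (L * S))) ^ 2) by ring.
        apply pow_incr; auto. }
      assert ((c * w t) ^ 2 <= c ^ 2 * (T * Q)).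
      { rewrite Rpow_mult_distr. apply Rmult_le_compat_l; [apply pow2_ge_0 | auto]. }
      unfold g.
      pose proof (pow2_ge_0 (w1 t - c * w t)). pose proof (pow2_ge_0 (w1 t - h t)).
      pose proof (pow2_ge_0 (c * w t - h t)). nra. }
    rewrite RInt_add, RInt_cmul, RInt_cst in J by solve_cont. fold Q in J.
    unfold B. nra. }
  assert (Et : tau * B = 1 - kap) by (unfold tau; field; lra).
  assert (Ht : 0 < tau) by (unfold tau; apply Rdiv_lt_0_compat; lra).
  replace ((1 - kap) ^ 2 / B) with (tau * (1 - kap)) by (unfold tau; field; lra).
  assert (G1 : tau ^ 2 * RInt (fun t => g t ^ 2) 0 T <= tau * (tau * B) * Q).
  { replace (tau * (tau * B) * Q) with (tau ^ 2 * (B * Q)) by ring.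
    apply Rmult_le_compat_l; [apply pow2_ge_0 | auto]. }
  rewrite Et in G1.
  assert (G2 : tau * ((1 - kap) * Q) <= tau * RInt (fun t => w1 t * g t) 0 T)
    by (apply Rmult_le_compat_l; lra).
  lra.
Qed.

(** * Uniform limits *)

Lemma geometric_small A rho : 0 <= rho < 1 -> forall eps, 0 < eps ->
  exists n, A * rho ^ n < eps.
Proof.
  intros Hr eps He.
  destruct (pow_lt_1_zero rho ltac:(rewrite Rabs_pos_eq; lra) (eps / (Rabs A + 1))) as [n Hn].
  { apply Rdiv_lt_0_compat; auto. pose proof (Rabs_pos A). lra. }
  exists n. specialize (Hn n (Nat.le_refl n)).
  pose proof (pow_le rho n (proj1 Hr)) as Hp. rewrite Rabs_pos_eq in Hn by auto.
  pose proof (Rabs_pos A). pose proof (Rle_abs A).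
  assert ((Rabs A + 1) * rho ^ n < eps).
  { apply Rmult_lt_reg_r with (/ (Rabs A + 1)); [apply Rinv_0_lt_compat; lra|].
    replace ((Rabs A + 1) * rho ^ n * / (Rabs A + 1)) with (rho ^ n) by (field; lra). auto. }
  nra.
Qed.

Lemma le_geometric_zero A rho x : 0 <= rho < 1 -> (forall n, Rabs x <= A * rho ^ n) -> x = 0.
Proof.
  intros Hr H. destruct (Req_dec x 0) as [|Hx]; auto. exfalso.
  destruct (geometric_small A rho Hr (Rabs x)) as [n Hn].
  - now apply Rabs_pos_lt.
  - specialize (H n). lra.
Qed.

Lemma geometric_limit (f : nat -> R -> R) A rho : 0 <= rho < 1 ->
  (forall n t, Rabs (f (S n) t - f n t) <= A * rho ^ n) ->
  exists l, forall n t, Rabs (l t - f n t) <= A / (1 - rho) * rho ^ n.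
Proof.
  intros Hr H.
  assert (HA : 0 <= A).
  { specialize (H 0%nat 0). simpl in H. pose proof (Rabs_pos (f 1%nat 0 - f 0%nat 0)). lra. }
  assert (Hq : 0 <= A / (1 - rho)).
  { apply Rmult_le_pos; auto. left; apply Rinv_0_lt_compat; lra. }
  assert (Hk : forall k n t, Rabs (f (n + k)%nat t - f n t)
                             <= A / (1 - rho) * (rho ^ n - rho ^ (n + k))).
  { induction k as [|k IH]; intros n t.
    - rewrite Nat.add_0_r, !Rminus_diag, Rabs_R0. lra.
    - rewrite Nat.add_succ_r.
      replace (f (S (n + k)) t - f n t)
        with ((f (S (n + k)) t - f (n + k)%nat t) + (f (n + k)%nat t - f n t)) by ring.
      eapply Rle_trans; [apply Rabs_triang|].
      specialize (H (n + k)%nat t). specialize (IH n t).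
      replace (A / (1 - rho) * (rho ^ n - rho ^ S (n + k)))
        with (A * rho ^ (n + k) + A / (1 - rho) * (rho ^ n - rho ^ (n + k)))
        by (simpl; field; lra).
      lra. }
  assert (Hk' : forall n m t, (n <= m)%nat -> Rabs (f m t - f n t) <= A / (1 - rho) * rho ^ n).
  { intros n m t Hnm. replace m with (n + (m - n))%nat by lia.
    eapply Rle_trans; [apply Hk|]. apply Rmult_le_compat_l; auto.
    pose proof (pow_le rho (n + (m - n)) (proj1 Hr)). lra. }
  assert (Hlim : forall t, ex_finite_lim_seq (fun n => f n t)).
  { intro t. apply ex_lim_seq_cauchy_corr. intros eps.
    destruct (geometric_small (2 * (A / (1 - rho))) rho Hr eps (cond_pos eps)) as [n0 Hn0].
    exists n0. intros n m Hn Hm.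
    pose proof (Hk' n0 n t Hn) as B1. pose proof (Hk' n0 m t Hm) as B2.
    replace (f n t - f m t) with ((f n t - f n0 t) + - (f m t - f n0 t)) by ring.
    eapply Rle_lt_trans; [apply Rabs_triang|]. rewrite Rabs_Ropp. lra. }
  exists (fun t => real (Lim_seq (fun n => f n t))).
  intros n t.
  destruct (Hlim t) as [l Hl].
  rewrite (is_lim_seq_unique _ _ Hl). simpl.
  assert (Hl' : is_lim_seq (fun m => Rabs (f m t - f n t)) (Rabs (l - f n t))).
  { apply (is_lim_seq_abs (fun m => f m t - f n t) (l - f n t)).
    apply is_lim_seq_minus'; auto. apply is_lim_seq_const. }
  apply (is_lim_seq_le_loc (fun m => Rabs (f m t - f n t)) (fun _ => A / (1 - rho) * rho ^ n)
           (Rabs (l - f n t)) (A / (1 - rho) * rho ^ n)); auto.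
  - exists n. intros m Hm. now apply Hk'.
  - apply is_lim_seq_const.
Qed.

Lemma cont_uniform_limit (f : nat -> R -> R) l A rho : 0 <= rho < 1 ->
  (forall n, cont (f n)) -> (forall n t, Rabs (l t - f n t) <= A * rho ^ n) -> cont l.
Proof.
  intros Hr Hc H t.
  apply (filterlim_locally l (l t)). intro eps.
  destruct (geometric_small A rho Hr (eps / 3)) as [n Hn].
  { pose proof (cond_pos eps); lra. }
  assert (He : 0 < eps / 3) by (pose proof (cond_pos eps); lra).
  pose proof (proj1 (filterlim_locally (f n) (f n t)) (Hc n t) (mkposreal _ He)) as L.
  apply (filter_imp (fun x => ball (f n t) (mkposreal _ He) (f n x))); auto.
  intros x Hx.
  change (Rabs (f n x - f n t) < eps / 3) in Hx.
  change (Rabs (l x - l t) < eps).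
  pose proof (H n x) as B1. pose proof (H n t) as B2.
  replace (l x - l t) with ((l x - f n x) + (f n x - f n t) + - (l t - f n t)) by ring.
  eapply Rle_lt_trans; [apply Rabs_triang|]. rewrite Rabs_Ropp.
  eapply Rle_lt_trans; [apply Rplus_le_compat_r, Rabs_triang|]. lra.
Qed.

Lemma mean_free_uniform_limit T (f : nat -> R -> R) l A rho : 0 < T -> 0 <= rho < 1 ->
  (forall n, mean_free T (f n)) -> (forall n t, Rabs (l t - f n t) <= A * rho ^ n) ->
  mean_free T l.
Proof.
  intros HT Hr Hc H.
  assert (Hl : cont l).
  { apply (cont_uniform_limit f l A rho Hr); auto. intro n; apply Hc. }
  repeat split; auto.
  - intro t. apply Rminus_diag_uniq. apply (le_geometric_zero (2 * A) rho); auto. intro n.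
    pose proof (H n (t + T)) as B1. pose proof (H n t) as B2.
    rewrite (proj1 (proj2 (Hc n))) in B1.
    replace (l (t + T) - l t) with ((l (t + T) - f n t) + - (l t - f n t)) by ring.
    eapply Rle_trans; [apply Rabs_triang|]. rewrite Rabs_Ropp. lra.
  - rewrite RInt_average by lra.
    assert (E : average T l = 0); [|rewrite E; apply Rmult_0_r].
    apply (le_geometric_zero A rho); auto. intro n.
    assert (E : average T (f n) = 0).
    { unfold average. rewrite (proj2 (proj2 (Hc n))). ring. }
    rewrite <- (Rminus_0_r (average T l)), <- E.
    apply average_diff_le; auto. apply Hc.
Qed.

Fixpoint iterate (T c tau : R) (N : R -> R -> R) (n : nat) : R -> R :=
  match n with
  | O => fun _ => 0
  | S n => step T c tau N (iterate T c tau N n)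
  end.

Fixpoint iterate_deriv (T c tau : R) (N : R -> R -> R) (n : nat) : R -> R :=
  match n with
  | O => fun _ => 0
  | S n => step_deriv T c tau N (iterate T c tau N n) (iterate_deriv T c tau N n)
  end.

Lemma iterate_regular T c tau L M N n : 0 < T -> admissible T L M N ->
  mean_free T (iterate T c tau N n) /\
  has_deriv (iterate T c tau N n) (iterate_deriv T c tau N n) /\
  cont (iterate_deriv T c tau N n).
Proof.
  intros HT HN. induction n as [|n IH]; simpl.
  - split; [|split; [apply has_deriv_const | apply cont_const]].
    split; [apply cont_const | split; [intro t; auto|]].
    rewrite RInt_cst. apply Rmult_0_r.
  - destruct IH as [I1 [I2 I3]].
    assert (HF := forcing_mean_free T L M N _ HT HN I1).
    pose proof (prim_deriv T _ (proj1 HF)) as Pd.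
    split; [|split].
    + unfold step. apply mean_free_sub; [exact I1|]. apply mean_free_scal.
      now apply (residual_mean_free T c L M).
    + unfold step, step_deriv. apply has_deriv_minus; auto.
      apply has_deriv_scal. now apply (residual_has_deriv T c L M).
    + unfold step_deriv, residual_deriv.
      apply cont_minus; [exact I3|]. apply cont_mult; [apply cont_const|].
      apply cont_plus; [|exact (has_deriv_cont _ _ Pd)].
      apply cont_plus; [exact I3|]. apply cont_mult; [apply cont_const | exact (proj1 I1)].
Qed.

Theorem periodic_solution_exists T c L M N : 0 < T -> 0 <= L -> 0 <= M ->
  M < (2 * PI / T) ^ 2 -> admissible T L M N ->
  exists w w1 w2 m, has_deriv w w1 /\ has_deriv w1 w2 /\ cont w2 /\ mean_free T w /\
    forall t, w2 t + c * w1 t + N t (w t) = m.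
Proof.
  intros HT HL HM HMw HN.
  destruct (step_contracts T c L M N HT HL HM HMw HN) as [tau [q [Htau [Hq Hcontr]]]].
  set (f := iterate T c tau N). set (f1 := iterate_deriv T c tau N).
  assert (Hreg : forall n, mean_free T (f n) /\ has_deriv (f n) (f1 n) /\ cont (f1 n))
    by (intro n; apply (iterate_regular T c tau L M N n HT HN)).
  set (Q0 := RInt (fun t => (f1 1%nat t - f1 0%nat t) ^ 2) 0 T).
  assert (HQn : forall n, RInt (fun t => (f1 (S n) t - f1 n t) ^ 2) 0 T <= Q0 * q ^ n).
  { induction n as [|n IH]; [rewrite pow_O, Rmult_1_r; apply Rle_refl|].
    destruct (Hreg n) as [A1 [A2 A3]]. destruct (Hreg (S n)) as [B1 [B2 B3]].
    eapply Rle_trans; [apply (Hcontr (f (S n)) (f1 (S n)) (f n) (f1 n)); auto|].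
    apply Rle_trans with (q * (Q0 * q ^ n)); [|simpl; lra].
    apply Rmult_le_compat_l; [lra | exact IH]. }
  assert (HQ0 : 0 <= Q0).
  { destruct (Hreg 0%nat) as [_ [_ C0]]. destruct (Hreg 1%nat) as [_ [_ C1]].
    apply RInt_nonneg; [lra | solve_cont | intro; apply pow2_ge_0]. }
  set (rho := sqrt q). set (A := sqrt (T * Q0)).
  assert (Hrho2 : rho ^ 2 = q) by (apply pow2_sqrt; lra).
  assert (HA2 : A ^ 2 = T * Q0) by (apply pow2_sqrt, Rmult_le_pos; lra).
  assert (HA : 0 <= A) by apply sqrt_pos.
  assert (Hrho : 0 <= rho < 1).
  { split; [apply sqrt_pos|]. rewrite <- sqrt_1. apply sqrt_lt_1; lra. }
  assert (Hinc : forall n t, Rabs (f (S n) t - f n t) <= A * rho ^ n).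
  { intros n t. destruct (Hreg n) as [A1 [A2 A3]]. destruct (Hreg (S n)) as [B1 [B2 B3]].
    destruct (mean_free_sub T _ _ B1 A1) as [_ [D2 D3]].
    pose proof (sup_le_energy T _ _ HT (has_deriv_minus _ _ _ _ B2 A2) ltac:(solve_cont) D2 D3 t)
      as E. cbv beta in E.
    rewrite <- (Rabs_pos_eq (A * rho ^ n))
      by (apply Rmult_le_pos; auto; apply pow_le; lra).
    apply Rsqr_le_abs_0. unfold Rsqr.
    replace (A * rho ^ n * (A * rho ^ n)) with (T * (Q0 * q ^ n)).
    - specialize (HQn n).
      assert (T * RInt (fun t => (f1 (S n) t - f1 n t) ^ 2) 0 T <= T * (Q0 * q ^ n))
        by (apply Rmult_le_compat_l; lra). nra.
    - rewrite <- Hrho2, <- pow_mult, Nat.mul_comm, pow_mult.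
      rewrite <- Rmult_assoc, <- HA2. ring. }
  destruct (geometric_limit f A rho Hrho Hinc) as [w Hw].
  assert (Hmf : mean_free T w).
  { apply (mean_free_uniform_limit T f w (A / (1 - rho)) rho); auto. intro n; apply Hreg. }
  assert (Hres : forall t, residual T c N w t = 0).
  { intro t. set (C := 1 + Rabs c * T + 2 * L * T ^ 2).
    apply (le_geometric_zero (C * (A / (1 - rho)) + A / tau) rho); auto. intro n.
    pose proof (residual_lipschitz T c L M N w (f n) _ HT HL HN Hmf (proj1 (Hreg n)) (Hw n) t)
      as R1. fold C in R1.
    pose proof (Hinc n t) as R2.
    assert (E : f (S n) t - f n t = - (tau * residual T c N (f n) t))
      by (unfold f; simpl; unfold step; ring).
    rewrite E, Rabs_Ropp, Rabs_mult, (Rabs_pos_eq tau) in R2 by lra.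
    assert (R3 : Rabs (residual T c N (f n) t) <= A / tau * rho ^ n).
    { apply Rmult_le_reg_l with tau; auto.
      replace (tau * (A / tau * rho ^ n)) with (A * rho ^ n) by (field; lra). auto. }
    replace (residual T c N w t)
      with ((residual T c N w t - residual T c N (f n) t) + residual T c N (f n) t) by ring.
    eapply Rle_trans; [apply Rabs_triang|]. lra. }
  assert (HF := forcing_mean_free T L M N w HT HN Hmf).
  set (fw := forcing T N w) in *.
  pose proof (prim_deriv T w (proj1 Hmf)) as D1.
  pose proof (prim_deriv T fw (proj1 HF)) as D2.
  pose proof (prim_deriv T (prim T fw) (proj1 (prim_mean_free T fw HT HF))) as D3.
  set (w1 := fun t => (- c) * w t - prim T fw t).
  assert (Hd1 : has_deriv w w1).
  { apply (has_deriv_ext (fun t => (- c) * prim T w t - prim T (prim T fw) t) w1); auto.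
    - intro t. specialize (Hres t). unfold residual in Hres. fold fw in Hres. lra.
    - apply has_deriv_minus; auto. now apply has_deriv_scal. }
  set (w2 := fun t => (- c) * w1 t - fw t).
  assert (Hd2 : has_deriv w1 w2).
  { apply has_deriv_minus; auto. now apply has_deriv_scal. }
  assert (Cfw : cont fw) by apply HF. assert (Cw : cont w) by apply Hmf.
  exists w, w1, w2, (average T (fun t => N t (w t))).
  split; [exact Hd1 | split; [exact Hd2 | split; [|split; [exact Hmf|]]]].
  - unfold w2. assert (Cw1 : cont w1) by exact (has_deriv_cont w1 w2 Hd2). solve_cont.
  - intro t. unfold w2, fw, forcing, center. ring.
Qed.

(** * The singular force *)

Definition g (x : R) : R := 1 / x ^ 4 - 1 / x ^ 3.
Definition g' (x : R) : R := 3 / x ^ 4 - 4 / x ^ 5.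
Definition g'' (x : R) : R := 20 / x ^ 6 - 12 / x ^ 5.

Lemma g_deriv x : 0 < x -> is_derive g x (g' x).
Proof.
  intros Hx. unfold g, g'. auto_derive.
  - repeat split; apply Rgt_not_eq; repeat apply Rmult_lt_0_compat; lra.
  - field. lra.
Qed.

Lemma g'_deriv x : 0 < x -> is_derive g' x (g'' x).
Proof.
  intros Hx. unfold g', g''. auto_derive.
  - repeat split; apply Rgt_not_eq; repeat apply Rmult_lt_0_compat; lra.
  - field. lra.
Qed.

Lemma g_cont x : 0 < x -> continuous g x.
Proof. intros Hx. apply (ex_derive_continuous g x). exists (g' x). now apply g_deriv. Qed.

Lemma g'_cont x : 0 < x -> continuous g' x.
Proof. intros Hx. apply (ex_derive_continuous g' x). exists (g'' x). now apply g'_deriv. Qed.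

Lemma mean_value_pos f f' x y : (forall s, 0 < s -> is_derive f s (f' s)) -> 0 < x -> x < y ->
  exists s, x < s < y /\ f y - f x = f' s * (y - x).
Proof.
  intros Hf Hx Hxy. destruct (MVT_cor2 f f' x y Hxy) as [s [H1 H2]].
  - intros; apply is_derive_Reals, Hf. lra.
  - now exists s.
Qed.

(** With [s = 1 / x] the bound reads [4 s^5 - 3 s^4 + 3^5 / 5^5 >= 0], and the left-hand side has
    the double root [s = 3 / 5]. *)
Lemma g'_le_max x : 0 < x -> g' x <= 3 ^ 5 / 5 ^ 5.
Proof.
  intros Hx. set (s := / x). assert (Hs : 0 < s) by now apply Rinv_0_lt_compat.
  replace (g' x) with (3 * s ^ 4 - 4 * s ^ 5) by (unfold g', s; field; lra).
  assert (0 <= (s - 3 / 5) ^ 2 * (4 * s ^ 3 + 9 / 5 * s ^ 2 + 18 / 25 * s + 27 / 125)).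
  { apply Rmult_le_pos; [apply pow2_ge_0|].
    pose proof (pow_lt s 2 Hs). pose proof (pow_lt s 3 Hs). lra. }
  assert (E : (s - 3 / 5) ^ 2 * (4 * s ^ 3 + 9 / 5 * s ^ 2 + 18 / 25 * s + 27 / 125)
          = 4 * s ^ 5 - 3 * s ^ 4 + 243 / 3125) by field.
  lra.
Qed.

Lemma inv_pow_le d x n : 0 < d -> d <= x -> 0 < / x ^ n <= / d ^ n.
Proof.
  intros Hd Hx. split.
  - apply Rinv_0_lt_compat, pow_lt; lra.
  - apply Rinv_le_contravar; [now apply pow_lt | apply pow_incr; lra].
Qed.

Lemma g'_bounded d : 0 < d -> exists L, 0 <= L /\ forall x, d <= x -> Rabs (g' x) <= L.
Proof.
  intros Hd. exists (3 * / d ^ 4 + 4 * / d ^ 5). split.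
  - pose proof (inv_pow_le d d 4 Hd (Rle_refl d)). pose proof (inv_pow_le d d 5 Hd (Rle_refl d)).
    lra.
  - intros x Hx. unfold g', Rdiv. apply Rabs_le.
    pose proof (inv_pow_le d x 4 Hd Hx). pose proof (inv_pow_le d x 5 Hd Hx). lra.
Qed.

Lemma g''_bounded d : 0 < d -> exists K, 0 <= K /\ forall x, d <= x -> Rabs (g'' x) <= K.
Proof.
  intros Hd. exists (20 * / d ^ 6 + 12 * / d ^ 5). split.
  - pose proof (inv_pow_le d d 6 Hd (Rle_refl d)). pose proof (inv_pow_le d d 5 Hd (Rle_refl d)).
    lra.
  - intros x Hx. unfold g'', Rdiv. apply Rabs_le.
    pose proof (inv_pow_le d x 6 Hd Hx). pose proof (inv_pow_le d x 5 Hd Hx). lra.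
Qed.

Lemma lipschitz_of_deriv_bound f f' d L : 0 < d ->
  (forall s, 0 < s -> is_derive f s (f' s)) -> (forall x, d <= x -> Rabs (f' x) <= L) ->
  forall x y, d <= x -> d <= y -> Rabs (f x - f y) <= L * Rabs (x - y).
Proof.
  intros Hd Hf HL.
  assert (W : forall x y, d <= x -> x < y -> Rabs (f y - f x) <= L * Rabs (y - x)).
  { intros x y Hx Hxy. destruct (mean_value_pos f f' x y Hf ltac:(lra) Hxy) as [s [Hs1 Hs2]].
    rewrite Hs2, Rabs_mult. apply Rmult_le_compat_r; [apply Rabs_pos|]. apply HL. lra. }
  intros x y Hx Hy. destruct (Rtotal_order x y) as [h|[->|h]].
  - rewrite Rabs_minus_sym, (Rabs_minus_sym x). now apply W.
  - rewrite !Rminus_diag, Rabs_R0. lra.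
  - now apply W.
Qed.

Lemma g_one_sided x y : 0 < x -> 0 < y -> (g x - g y) * (x - y) <= 3 ^ 5 / 5 ^ 5 * (x - y) ^ 2.
Proof.
  assert (W : forall x y, 0 < x -> x < y -> (g y - g x) * (y - x) <= 3 ^ 5 / 5 ^ 5 * (y - x) ^ 2).
  { clear. intros x y Hx Hxy. destruct (mean_value_pos g g' x y g_deriv Hx Hxy) as [s [Hs1 Hs2]].
    rewrite Hs2. replace (g' s * (y - x) * (y - x)) with (g' s * (y - x) ^ 2) by ring.
    apply Rmult_le_compat_r; [apply pow2_ge_0|]. apply g'_le_max. lra. }
  intros Hx Hy. destruct (Rtotal_order x y) as [h|[->|h]].
  - specialize (W x y Hx h). lra.
  - rewrite !Rminus_diag. lra.
  - specialize (W y x Hy h). lra.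
Qed.

Lemma g_taylor d : 0 < d -> exists K, 0 <= K /\ forall x y, d <= x -> d <= y ->
  Rabs (g x - g y - g' y * (x - y)) <= K * (x - y) ^ 2.
Proof.
  intros Hd. destruct (g''_bounded d Hd) as [K [HK HK']]. exists K; split; auto.
  pose proof (lipschitz_of_deriv_bound g' g'' d K Hd g'_deriv HK') as HL.
  assert (W : forall s x y, d <= s -> d <= y -> Rabs (s - y) <= Rabs (x - y) ->
    g x - g y = g' s * (x - y) -> Rabs (g x - g y - g' y * (x - y)) <= K * (x - y) ^ 2).
  { intros s x y Hs Hy Hsy E. rewrite E.
    replace (g' s * (x - y) - g' y * (x - y)) with ((g' s - g' y) * (x - y)) by ring.
    rewrite Rabs_mult, <- (pow2_abs (x - y)).
    specialize (HL s y Hs Hy). pose proof (Rabs_pos (x - y)). pose proof (Rabs_pos (s - y)).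
    assert (K * Rabs (s - y) <= K * Rabs (x - y)) by (apply Rmult_le_compat_l; auto).
    nra. }
  intros x y Hx Hy. destruct (Rtotal_order x y) as [h|[->|h]].
  - destruct (mean_value_pos g g' x y g_deriv ltac:(lra) h) as [s [Hs1 Hs2]].
    apply (W s); try lra. rewrite !Rabs_left; lra.
  - rewrite !Rminus_diag, Rmult_0_r, Rminus_0_r, Rabs_R0. nra.
  - destruct (mean_value_pos g g' y x g_deriv ltac:(lra) h) as [s [Hs1 Hs2]].
    apply (W s); try lra. rewrite !Rabs_pos_eq; lra.
Qed.

(** Convexity of [g] below its inflection point [5 / 3], as comparison of consecutive chords. *)
Lemma g_chords x y w : 0 < x -> x < y -> y < w -> w < 5 / 3 ->
  (g y - g x) * (w - y) < (g w - g y) * (y - x).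
Proof.
  intros Hx Hxy Hyw Hw.
  destruct (mean_value_pos g g' x y g_deriv Hx Hxy) as [s [Hs1 Hs2]].
  destruct (mean_value_pos g g' y w g_deriv ltac:(lra) Hyw) as [r [Hr1 Hr2]].
  destruct (mean_value_pos g' g'' s r g'_deriv ltac:(lra) ltac:(lra)) as [p [Hp1 Hp2]].
  rewrite Hs2, Hr2.
  assert (Hpp : 0 < g'' p).
  { replace (g'' p) with ((20 - 12 * p) / p ^ 6) by (unfold g''; field; lra).
    apply Rdiv_lt_0_compat; [lra | apply pow_lt; lra]. }
  assert (0 < g'' p * (r - s)) by (apply Rmult_lt_0_compat; lra).
  assert (0 < (y - x) * (w - y)) by (apply Rmult_lt_0_compat; lra). nra.
Qed.

Lemma g_le_above eta x : 0 < eta -> eta <= x -> g x <= / eta ^ 4.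
Proof.
  intros He Hx. unfold g, Rdiv.
  pose proof (inv_pow_le eta x 4 He Hx). pose proof (inv_pow_le eta x 3 He Hx). lra.
Qed.

Lemma g_large_near_0 B : exists d, 0 < d < 1 /\ forall x, 0 < x -> x <= d -> B < g x.
Proof.
  pose proof (Rabs_pos B) as HB. pose proof (Rle_abs B) as HB'.
  exists (/ (2 * (Rabs B + 2))).
  assert (Hd : 0 < / (2 * (Rabs B + 2)) <= / 4).
  { split; [apply Rinv_0_lt_compat; lra | apply Rinv_le_contravar; lra]. }
  split; [lra|]. intros x Hx Hxd.
  assert (H1 : 2 * (Rabs B + 2) <= / x).
  { rewrite <- (Rinv_inv (2 * (Rabs B + 2))). apply Rinv_le_contravar; auto. }
  assert (H2 : 1 <= / x ^ 3).
  { rewrite <- Rinv_1. apply Rinv_le_contravar; [now apply pow_lt|].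
    rewrite <- (pow1 3). apply pow_incr. lra. }
  replace (g x) with ((1 - x) * (/ x ^ 3 * / x)) by (unfold g; field; lra).
  assert (/ x <= / x ^ 3 * / x) by nra. nra.
Qed.

Lemma g_neg x : 1 < x -> g x < 0.
Proof.
  intros Hx. replace (g x) with (- ((x - 1) / x ^ 4)) by (unfold g; field; lra).
  assert (0 < (x - 1) / x ^ 4) by (apply Rdiv_lt_0_compat; [lra | apply pow_lt; lra]). lra.
Qed.

Lemma g_small x : 1 <= x -> Rabs (g x) <= / x.
Proof.
  intros Hx.
  assert (H0 : 0 < / x <= 1).
  { split; [apply Rinv_0_lt_compat; lra|]. rewrite <- Rinv_1. apply Rinv_le_contravar; lra. }
  replace (g x) with (/ x * (/ x ^ 2 * (/ x - 1))) by (unfold g; field; lra).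
  pose proof (inv_pow_le 1 x 2 ltac:(lra) Hx) as H2. rewrite pow1, Rinv_1 in H2.
  apply Rabs_le. split; [|assert (/ x ^ 2 * (/ x - 1) <= 0) by nra; nra].
  assert (-1 <= / x ^ 2 * (/ x - 1)) by nra. nra.
Qed.

Lemma g'_zero x : 0 < x -> g' x = 0 -> x = 4 / 3.
Proof.
  intros Hx H. replace (g' x) with ((3 * x - 4) / x ^ 5) in H by (unfold g'; field; lra).
  assert (H5 : 0 < x ^ 5) by now apply pow_lt.
  assert (E : 3 * x - 4 = 0); [|lra].
  replace (3 * x - 4) with ((3 * x - 4) / x ^ 5 * x ^ 5) by (field; lra). rewrite H. ring.
Qed.

(** Extending [g] by a constant below [d] removes the singularity and keeps the one-sided bound. *)
Definition g_trunc (d x : R) : R := g (Rmax x d).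

Lemma g_trunc_one_sided d x y : 0 < d ->
  (g_trunc d x - g_trunc d y) * (x - y) <= 3 ^ 5 / 5 ^ 5 * (x - y) ^ 2.
Proof.
  intros Hd. unfold g_trunc.
  (* truncation is monotone and 1-Lipschitz, so it can only shrink the increment x - y *)
  assert (W : forall x y, y < x ->
    (g (Rmax x d) - g (Rmax y d)) * (x - y) <= 3 ^ 5 / 5 ^ 5 * (x - y) ^ 2).
  { clear x y. intros x y Hxy.
    pose proof (Rmax_l x d). pose proof (Rmax_r x d).
    pose proof (Rmax_l y d). pose proof (Rmax_r y d).
    assert (HX : 0 <= Rmax x d - Rmax y d <= x - y).
    { unfold Rmax. destruct (Rle_dec x d), (Rle_dec y d); lra. }
    set (X := Rmax x d) in *. set (Y := Rmax y d) in *.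
    pose proof (g_one_sided X Y ltac:(lra) ltac:(lra)) as G.
    destruct (Req_dec X Y) as [->|Hne].
    - rewrite Rminus_diag. pose proof (pow2_ge_0 (x - y)). lra.
    - assert (G' : g X - g Y <= 3 ^ 5 / 5 ^ 5 * (X - Y))
        by (apply Rmult_le_reg_r with (X - Y); lra).
      assert (g X - g Y <= 3 ^ 5 / 5 ^ 5 * (x - y)) by lra. nra. }
  destruct (Rtotal_order x y) as [h|[->|h]].
  - specialize (W y x h). lra.
  - rewrite !Rminus_diag. lra.
  - now apply W.
Qed.

Lemma g_trunc_lipschitz d : 0 < d -> exists L, 0 <= L /\
  forall x y, Rabs (g_trunc d x - g_trunc d y) <= L * Rabs (x - y).
Proof.
  intros Hd. destruct (g'_bounded d Hd) as [L [HL HL']]. exists L; split; auto.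
  intros x y. unfold g_trunc.
  eapply Rle_trans; [apply (lipschitz_of_deriv_bound g g' d L Hd g_deriv HL'); apply Rmax_r|].
  apply Rmult_le_compat_l; auto.
  unfold Rmax. destruct (Rle_dec x d), (Rle_dec y d);
    unfold Rabs; repeat destruct Rcase_abs; lra.
Qed.

Lemma g_trunc_cont d u : 0 < d -> cont u -> cont (fun t => g_trunc d (u t)).
Proof.
  intros Hd Hu. unfold g_trunc.
  apply (cont_comp (fun t => Rmax (u t) d)).
  - intro t. apply (continuous_ext (fun t => (u t + d + Rabs (u t - d)) / 2)).
    + intro x. unfold Rmax, Rabs. destruct Rle_dec, Rcase_abs; lra.
    + revert t. change (cont (fun t => (u t + d + Rabs (u t - d)) * / 2)).
      apply cont_mult; [apply cont_plus; [solve_cont|] | solve_cont].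
      apply (cont_comp (fun t => u t - d)); [solve_cont|].
      intro t. apply continuous_Rabs.
  - intro t. apply g_cont. pose proof (Rmax_r (u t) d). lra.
Qed.

(** * Solution pairs *)

Record setting (T a c : R) (e : R -> R) : Prop := {
  set_T : 0 < T;
  set_cont : cont e;
  set_per : periodic T e;
  set_mean : RInt e 0 T = 0;
  set_a : 0 < a;
  set_small : a * (3 ^ 5 / 5 ^ 5) < (2 * PI / T) ^ 2 }.

Record solution (T a c : R) (e : R -> R) (u u1 u2 : R -> R) (mu : R) : Prop := {
  sol_d1 : has_deriv u u1;
  sol_d2 : has_deriv u1 u2;
  sol_cont : cont u2;
  sol_per : periodic T u;
  sol_pos : forall t, 0 < u t;
  sol_eq : forall t, u2 t + c * u1 t + a * g (u t) = mu + e t }.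

Lemma cont_g_comp u : cont u -> (forall t, 0 < u t) -> cont (fun t => g (u t)).
Proof. intros Hu Hpos. apply cont_comp; auto. intro t. now apply g_cont. Qed.

Lemma cont_g'_comp u : cont u -> (forall t, 0 < u t) -> cont (fun t => g' (u t)).
Proof. intros Hu Hpos. apply cont_comp; auto. intro t. now apply g'_cont. Qed.

Lemma solution_pair_solution T a c e u mu : cont e -> solution_pair T a c e u mu ->
  solution T a c e u (Derive u) (Derive (Derive u)) mu.
Proof.
  intros He [Hpos [Hper Hode]].
  assert (H1 : has_deriv u (Derive u)) by (intro t; apply Derive_correct, Hode).
  assert (H2 : has_deriv (Derive u) (Derive (Derive u)))
    by (intro t; apply Derive_correct, Hode).
  assert (Heq : forall t, Derive (Derive u) t + c * Derive u t + a * g (u t) = mu + e t)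
    by (intro t; apply Hode).
  constructor; auto.
  assert (Hg : cont (fun t => g (u t))) by (apply cont_g_comp; [solve_cont | auto]).
  assert (Hd : cont (Derive u)) by solve_cont.
  intro t. apply (continuous_ext (fun t => mu + e t - c * Derive u t - a * g (u t))).
  - intro s. specialize (Heq s). lra.
  - revert t. change (cont (fun t => mu + e t - c * Derive u t - a * g (u t))).
    apply cont_minus; [solve_cont|]. apply cont_mult; [apply cont_const | exact Hg].
Qed.

Lemma solution_solution_pair T a c e u u1 u2 mu : solution T a c e u u1 u2 mu ->
  solution_pair T a c e u mu.
Proof.
  intros [H1 H2 _ Hper Hpos Heq]. split; [auto | split; auto].
  assert (E1 : forall t, Derive u t = u1 t) by (intro t; apply is_derive_unique, H1).
  intro t.
  assert (E2 : Derive (Derive u) t = u2 t).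
  { rewrite (Derive_ext (Derive u) u1) by auto. apply is_derive_unique, H2. }
  split; [|split].
  - exists (u1 t). apply H1.
  - exists (u2 t). apply (is_derive_ext u1 (Derive u)); [intro; now rewrite E1 | apply H2].
  - rewrite E1, E2. apply Heq.
Qed.

Lemma average_attained T u : 0 < T -> cont u -> exists s, u s = average T u.
Proof.
  intros HT Hu. destruct (RInt_mean_value u 0 T Hu HT) as [s [_ Hs]].
  exists s. unfold average. rewrite <- Hs. field. lra.
Qed.

Lemma average_add T f k : 0 < T -> cont f -> average T (fun t => k + f t) = k + average T f.
Proof.
  intros HT Hf. unfold average. rewrite RInt_add, RInt_cst by solve_cont. field. lra.
Qed.

(** The differential terms have mean zero by periodicity. *)
Lemma constant_is_average T c w w1 w2 f m : 0 < T -> has_deriv w w1 -> has_deriv w1 w2 ->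
  cont w2 -> cont f -> periodic T w -> (forall t, w2 t + c * w1 t + f t = m) ->
  m = average T f.
Proof.
  intros HT H1 H2 Hc2 Hf Hp Heq.
  assert (Hc1 : cont w1) by solve_cont.
  pose proof (RInt_deriv w w1 0 T H1 Hc1) as I1.
  pose proof (RInt_deriv w1 w2 0 T H2 Hc2) as I2.
  pose proof (Hp 0) as P0. pose proof (periodic_deriv T w w1 H1 Hp 0) as P1.
  rewrite Rplus_0_l in P0, P1. rewrite P0 in I1. rewrite P1 in I2.
  assert (E : RInt (fun t => w2 t + c * w1 t + f t) 0 T = RInt (fun _ => m) 0 T)
    by (apply RInt_same; auto).
  rewrite RInt_add, RInt_add, RInt_cmul, RInt_cst, I1, I2, (RInt_average T f) in E
    by (solve_cont || lra).
  apply Rmult_eq_reg_l with T; lra.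
Qed.

Lemma average_abs_le T f B : 0 < T -> cont f -> (forall t, Rabs (f t) <= B) ->
  Rabs (average T f) <= B.
Proof.
  intros HT Hf HB. destruct (average_attained T f HT Hf) as [s <-]. apply HB.
Qed.

(** * A priori bounds *)

(** At a maximum of [u] the equation bounds [mu] above by the force there, and at a minimum it
    bounds the force by [mu]; the maximum exceeds the average, where the force is controlled. *)
Lemma force_at_min_le T c G e E B u u1 u2 mu : 0 < T -> has_deriv u u1 -> has_deriv u1 u2 ->
  periodic T u -> (forall t, Rabs (e t) <= E) -> (forall x, average T u <= x -> G x <= B) ->
  (forall t, u2 t + c * u1 t + G (u t) = mu + e t) ->
  exists m, (forall t, u m <= u t) /\ G (u m) <= mu + E /\ mu <= B + E.
Proof.
  intros HT H1 H2 Hp HE HB Heq.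
  assert (Hc : cont u) by solve_cont.
  destruct (periodic_min T u HT Hc Hp) as [m Hm].
  destruct (periodic_max T u HT Hc Hp) as [p Hpm].
  destruct (second_deriv_at_min u u1 u2 m H1 H2 Hm) as [M1 M2].
  destruct (second_deriv_at_min (fun t => -1 * u t) (fun t => -1 * u1 t) (fun t => -1 * u2 t) p)
    as [P1 P2]; try (now apply has_deriv_scal).
  { intro t. specialize (Hpm t). lra. }
  destruct (average_attained T u HT Hc) as [s Hs].
  exists m. split; auto.
  pose proof (Heq m) as Qm. pose proof (Heq p) as Qp.
  pose proof (HE m) as Em. pose proof (HE p) as Ep.
  apply Rabs_le_between in Em, Ep.
  assert (E0 : u1 p = 0) by lra.
  rewrite M1 in Qm. rewrite E0 in Qp.
  specialize (HB (u p)). rewrite <- Hs in HB. specialize (HB (Hpm s)). lra.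
Qed.

(** The same threshold works for the truncated force, which is what makes the truncation
    harmless. *)
Lemma truncation_threshold T a c e eta : setting T a c e -> 0 < eta ->
  exists d, 0 < d < 1 /\ forall G u u1 u2 mu,
    has_deriv u u1 -> has_deriv u1 u2 -> periodic T u -> eta <= average T u ->
    (forall x, eta <= x -> G x <= a * / eta ^ 4) ->
    (forall t, u2 t + c * u1 t + G (u t) = mu + e t) ->
    (forall t, u t <= d -> exists y, 0 < y <= d /\ G (u t) = a * g y) ->
    forall t, d < u t.
Proof.
  intros HS He. pose proof (set_T _ _ _ _ HS) as HT. pose proof (set_a _ _ _ _ HS) as Ha.
  destruct (periodic_bounded T e HT (set_cont _ _ _ _ HS) (set_per _ _ _ _ HS)) as [E [HE0 HE]].
  destruct (g_large_near_0 ((a * / eta ^ 4 + 2 * E) / a)) as [d [Hd Hg]].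
  exists d. split; auto.
  intros G u u1 u2 mu H1 H2 Hp Hav HG Heq Hlow t.
  destruct (force_at_min_le T c G e E (a * / eta ^ 4) u u1 u2 mu) as [m [M1 [M2 M3]]]; auto.
  { intros x Hx. apply HG. lra. }
  destruct (Rlt_or_le d (u m)) as [h|h].
  - specialize (M1 t). lra.
  - exfalso. destruct (Hlow m h) as [y [Hy Ey]].
    specialize (Hg y ltac:(lra) ltac:(lra)).
    apply Rmult_lt_compat_l with (r := a) in Hg; auto.
    replace (a * ((a * / eta ^ 4 + 2 * E) / a)) with (a * / eta ^ 4 + 2 * E) in Hg
      by (field; split; lra).
    lra.
Qed.

Lemma solution_lower_bound T a c e eta : setting T a c e -> 0 < eta ->
  exists d, 0 < d /\ forall u u1 u2 mu, solution T a c e u u1 u2 mu ->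
    eta <= average T u -> forall t, d <= u t.
Proof.
  intros HS He. destruct (truncation_threshold T a c e eta HS He) as [d [Hd H]].
  exists d. split; [lra|]. intros u u1 u2 mu Hu Hav t. left.
  apply (H (fun x => a * g x) u u1 u2 mu); try apply Hu; auto.
  - intros x Hx. apply Rmult_le_compat_l; [left; apply HS | now apply g_le_above].
  - intros s Hs. exists (u s). split; [|auto]. split; [apply (sol_pos _ _ _ _ _ _ _ _ Hu) | auto].
Qed.

Lemma strength_nonneg a : 0 < a -> 0 <= a * (3 ^ 5 / 5 ^ 5).
Proof. intros; apply Rmult_le_pos; lra. Qed.

Lemma solution_exists T a c e xi : setting T a c e -> 0 < xi ->
  exists u u1 u2 mu, solution T a c e u u1 u2 mu /\ average T u = xi.
Proof.
  intros HS Hxi. pose proof (set_T _ _ _ _ HS) as HT. pose proof (set_a _ _ _ _ HS) as Ha.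
  destruct (truncation_threshold T a c e xi HS Hxi) as [d [Hd H]].
  destruct (g_trunc_lipschitz d ltac:(lra)) as [L [HL HL']].
  assert (HN : admissible T (a * L) (a * (3 ^ 5 / 5 ^ 5))
                 (fun t x => a * g_trunc d (xi + x) - e t)).
  { constructor.
    - intros w Hw. apply cont_minus; [|apply HS].
      apply cont_mult; [apply cont_const|].
      apply (g_trunc_cont d (fun t => xi + w t)); [lra | solve_cont].
    - intros t x. now rewrite (set_per _ _ _ _ HS).
    - intros t x y.
      replace (_ - _) with (a * (g_trunc d (xi + x) - g_trunc d (xi + y))) by ring.
      rewrite Rabs_mult, (Rabs_pos_eq a), Rmult_assoc by lra.
      apply Rmult_le_compat_l; [lra|].
      replace (x - y) with ((xi + x) - (xi + y)) by ring. apply HL'.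
    - intros t x y.
      pose proof (g_trunc_one_sided d (xi + x) (xi + y) ltac:(lra)) as G.
      replace (xi + x - (xi + y)) with (x - y) in G by ring.
      apply Rmult_le_compat_l with (r := a) in G; lra. }
  destruct (periodic_solution_exists T c _ _ _ HT (Rmult_le_pos _ _ (Rlt_le _ _ Ha) HL)
              (strength_nonneg a Ha) (set_small _ _ _ _ HS) HN)
    as [w [w1 [w2 [m [H1 [H2 [Hc [[Hwc [Hwp Hwm]] Heq]]]]]]]].
  set (u := fun t => xi + w t).
  assert (Hu1 : has_deriv u w1).
  { apply (has_deriv_ext u (fun t => 0 + w1 t)); auto; [intro; ring|].
    apply has_deriv_plus; auto. apply has_deriv_const. }
  assert (Hup : periodic T u) by (intro t; unfold u; now rewrite Hwp).
  assert (Hav : average T u = xi).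
  { unfold u. rewrite average_add by auto. unfold average. rewrite Hwm. ring. }
  assert (Heq' : forall t, w2 t + c * w1 t + a * g_trunc d (u t) = m + e t)
    by (intro t; specialize (Heq t); unfold u; lra).
  assert (Hlow : forall t, d < u t).
  { apply (H (fun x => a * g_trunc d x) u w1 w2 m); auto; [lra| |].
    - intros x Hx. apply Rmult_le_compat_l; [lra|].
      apply g_le_above; auto. eapply Rle_trans; [exact Hx | apply Rmax_l].
    - intros t Ht. exists d. split; [lra|]. unfold g_trunc. now rewrite Rmax_right. }
  exists u, w1, w2, m. split; auto. constructor; auto.
  - intro t. specialize (Hlow t). lra.
  - intro t. rewrite <- (Heq' t). unfold g_trunc. specialize (Hlow t).
    now rewrite Rmax_left by lra.
Qed.

(** * Dependence on the average *)

(** The a priori form in which coercivity bounds a supremum [S]: the error itself contains [S]. *)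
Lemma absorb S h P : 0 <= S -> 0 <= h -> 0 <= P -> S ^ 2 <= P * (S * h + h ^ 2) ->
  S <= (1 + 2 * P) * h.
Proof.
  intros HS Hh HP H. destruct (Rle_or_lt S ((1 + 2 * P) * h)) as [|Hlt]; auto. exfalso.
  assert (Hph : 0 <= P * h) by (apply Rmult_le_pos; auto).
  assert (HSh : h < S) by lra.
  assert (S * h + h ^ 2 <= 2 * (S * h)) by nra.
  assert (S ^ 2 <= P * (2 * (S * h))).
  { eapply Rle_trans; [exact H|]. apply Rmult_le_compat_l; auto. }
  assert (S * (S - 2 * P * h) <= 0) by lra. nra.
Qed.

Lemma average_sub T f k : 0 < T -> cont f -> cont k ->
  average T (fun t => f t - k t) = average T f - average T k.
Proof. intros HT Hf Hk. unfold average. rewrite RInt_sub by auto. field. lra. Qed.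

Lemma deviation_mean_free T f : 0 < T -> cont f -> periodic T f -> average T f = 0 ->
  mean_free T f.
Proof.
  intros HT Hf Hp H. split; [auto | split; auto].
  rewrite RInt_average, H by lra. apply Rmult_0_r.
Qed.

Lemma average_const T k : 0 < T -> average T (fun _ => k) = k.
Proof. intros HT. unfold average. rewrite RInt_cst. field. lra. Qed.

Lemma average_scal T k f : 0 < T -> cont f -> average T (fun t => k * f t) = k * average T f.
Proof. intros HT Hf. unfold average. rewrite RInt_cmul by auto. ring. Qed.

(** The deviation [W] of [u - v] from its mean [h] satisfies
    [W'' + c W' + a (g u - g v) = const]; testing with [W] and coercivity give [|W| <= C |h|]. *)
Lemma solution_lipschitz T a c e d : setting T a c e -> 0 < d ->
  exists C, 0 < C /\ forall u u1 u2 mu v v1 v2 nu,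
    solution T a c e u u1 u2 mu -> solution T a c e v v1 v2 nu ->
    (forall t, d <= u t) -> (forall t, d <= v t) ->
    (forall t, Rabs (u t - v t) <= C * Rabs (average T u - average T v)) /\
    Rabs (mu - nu) <= C * Rabs (average T u - average T v).
Proof.
  intros HS Hd. pose proof (set_T _ _ _ _ HS) as HT. pose proof (set_a _ _ _ _ HS) as Ha.
  destruct (g'_bounded d Hd) as [L [HL HL']].
  pose proof (lipschitz_of_deriv_bound g g' d L Hd g_deriv HL') as Lip.
  set (M := a * (3 ^ 5 / 5 ^ 5)).
  assert (HM : 0 <= M) by now apply strength_nonneg.
  destruct (coercivity T M HT HM (set_small _ _ _ _ HS)) as [A [HA Hco]].
  set (P := A * (2 * M + a * L)).
  assert (HaL : 0 <= a * L) by (apply Rmult_le_pos; lra).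
  assert (HP : 0 <= P) by (apply Rmult_le_pos; lra).
  set (C1 := 2 + 2 * P).
  exists (C1 * (1 + a * L)). split; [unfold C1; nra|].
  intros u u1 u2 mu v v1 v2 nu Hu Hv Hud Hvd.
  pose proof (sol_d1 _ _ _ _ _ _ _ _ Hu) as Du1. pose proof (sol_d1 _ _ _ _ _ _ _ _ Hv) as Dv1.
  pose proof (sol_d2 _ _ _ _ _ _ _ _ Hu) as Du2. pose proof (sol_d2 _ _ _ _ _ _ _ _ Hv) as Dv2.
  pose proof (sol_cont _ _ _ _ _ _ _ _ Hu) as Cu2.
  pose proof (sol_cont _ _ _ _ _ _ _ _ Hv) as Cv2.
  assert (Cu : cont u) by solve_cont. assert (Cv : cont v) by solve_cont.
  pose proof (cont_g_comp u Cu (sol_pos _ _ _ _ _ _ _ _ Hu)) as Cgu.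
  pose proof (cont_g_comp v Cv (sol_pos _ _ _ _ _ _ _ _ Hv)) as Cgv.
  set (h := average T u - average T v).
  set (W := fun t => (u t - v t) - h).
  assert (DW1 : has_deriv W (fun t => u1 t - v1 t)).
  { apply (has_deriv_ext W (fun t => (u1 t - v1 t) - 0)); auto; [intro; ring|].
    unfold W. apply has_deriv_minus; [now apply has_deriv_minus | apply has_deriv_const]. }
  assert (DW2 : has_deriv (fun t => u1 t - v1 t) (fun t => u2 t - v2 t))
    by now apply has_deriv_minus.
  assert (CW : cont W) by solve_cont.
  assert (PW : periodic T W).
  { intro t. unfold W.
    now rewrite (sol_per _ _ _ _ _ _ _ _ Hu), (sol_per _ _ _ _ _ _ _ _ Hv). }
  assert (MW : mean_free T W).
  { apply deviation_mean_free; auto. unfold W.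
    rewrite average_sub, average_sub, average_const by (auto; solve_cont). unfold h. ring. }
  set (f := fun t => a * (g (u t) - g (v t))).
  assert (Cf : cont f).
  { apply cont_mult; [apply cont_const | now apply cont_minus]. }
  assert (Eq : forall t, u2 t - v2 t + c * (u1 t - v1 t) + f t = mu - nu).
  { intro t. unfold f. pose proof (sol_eq _ _ _ _ _ _ _ _ Hu t).
    pose proof (sol_eq _ _ _ _ _ _ _ _ Hv t). lra. }
  destruct (periodic_max T (fun t => W t ^ 2) HT ltac:(solve_cont)) as [t0 Ht0].
  { intro t. now rewrite PW. }
  cbv beta in Ht0. set (S := Rabs (W t0)).
  assert (HS0 : 0 <= S) by apply Rabs_pos.
  assert (HS2 : S ^ 2 = W t0 ^ 2) by apply pow2_abs.
  assert (HWS : forall t, Rabs (W t) <= S).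
  { intro t. apply Rsqr_le_abs_0. specialize (Ht0 t). unfold Rsqr. lra. }
  assert (Hh : 0 <= Rabs h) by apply Rabs_pos.
  assert (HdS : forall t, Rabs (u t - v t) <= S + Rabs h).
  { intro t. replace (u t - v t) with (W t + h) by (unfold W; ring).
    eapply Rle_trans; [apply Rabs_triang|]. specialize (HWS t). lra. }
  assert (Hlip : forall t, Rabs (f t) <= a * L * Rabs (u t - v t)).
  { intro t. unfold f. rewrite Rabs_mult, (Rabs_pos_eq a), Rmult_assoc by lra.
    apply Rmult_le_compat_l; [lra|]. now apply Lip. }
  assert (HSh : S <= (1 + 2 * P) * Rabs h).
  { apply absorb; auto. rewrite HS2.
    eapply Rle_trans.
    - apply (Hco c W _ _ f (mu - nu) ((2 * M + a * L) * (S * Rabs h + Rabs h ^ 2)) DW1 DW2);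
        auto; [solve_cont | apply MW |].
      intro t.
      assert (G1 : f t * (u t - v t) <= M * (u t - v t) ^ 2).
      { unfold f, M.
        pose proof (g_one_sided (u t) (v t) (sol_pos _ _ _ _ _ _ _ _ Hu t)
                      (sol_pos _ _ _ _ _ _ _ _ Hv t)) as G.
        apply Rmult_le_compat_l with (r := a) in G; lra. }
      assert (G2 : - (f t * h) <= a * L * (S + Rabs h) * Rabs h).
      { eapply Rle_trans; [apply Rle_abs|]. rewrite Rabs_Ropp, Rabs_mult.
        apply Rmult_le_compat_r; auto. eapply Rle_trans; [apply Hlip|].
        apply Rmult_le_compat_l; auto. }
      assert (G3 : W t * h <= S * Rabs h).
      { eapply Rle_trans; [apply Rle_abs|]. rewrite Rabs_mult.
        apply Rmult_le_compat_r; auto. }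
      assert (G4 : M * (W t * h) <= M * (S * Rabs h)) by (apply Rmult_le_compat_l; auto).
      assert (G5 : h ^ 2 = Rabs h ^ 2) by (symmetry; apply pow2_abs).
      replace (f t * W t) with (f t * (u t - v t) + - (f t * h)) by (unfold W; ring).
      replace (u t - v t) with (W t + h) in G1 at 2 by (unfold W; ring).
      assert (0 <= M * Rabs h ^ 2) by (apply Rmult_le_pos; auto; apply pow2_ge_0).
      assert (M * (W t + h) ^ 2 = M * W t ^ 2 + 2 * (M * (W t * h)) + M * Rabs h ^ 2)
        by (rewrite <- G5; ring).
      lra.
    - unfold P. right. ring. }
  assert (HD : forall t, Rabs (u t - v t) <= C1 * Rabs h).
  { intro t. specialize (HdS t). unfold C1. lra. }
  split.
  - intro t. specialize (HD t). eapply Rle_trans; [exact HD|].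
    apply Rmult_le_compat_r; auto. assert (0 <= C1) by (unfold C1; lra). nra.
  - rewrite (constant_is_average T c W _ _ f (mu - nu) HT DW1 DW2) by (auto; solve_cont).
    apply average_abs_le; auto. intro t. eapply Rle_trans; [apply Hlip|].
    apply Rle_trans with (a * L * (C1 * Rabs h)).
    + apply Rmult_le_compat_l; auto.
    + assert (0 <= C1 * Rabs h) by (apply Rmult_le_pos; auto; unfold C1; lra). lra.
Qed.

Lemma solution_unique T a c e u u1 u2 mu v v1 v2 nu : setting T a c e ->
  solution T a c e u u1 u2 mu -> solution T a c e v v1 v2 nu ->
  average T u = average T v -> (forall t, u t = v t) /\ mu = nu.
Proof.
  intros HS Hu Hv Hav. pose proof (set_T _ _ _ _ HS) as HT.
  assert (Cu : cont u) by exact (has_deriv_cont _ _ (sol_d1 _ _ _ _ _ _ _ _ Hu)).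
  destruct (average_attained T u HT Cu) as [s Hs].
  assert (Hpos : 0 < average T u) by (rewrite <- Hs; apply (sol_pos _ _ _ _ _ _ _ _ Hu)).
  destruct (solution_lower_bound T a c e _ HS Hpos) as [d [Hd H]].
  destruct (solution_lipschitz T a c e d HS Hd) as [C [HC HL]].
  destruct (HL u u1 u2 mu v v1 v2 nu Hu Hv) as [L1 L2].
  - apply (H u u1 u2 mu Hu). lra.
  - apply (H v v1 v2 nu Hv). lra.
  - rewrite Hav, Rminus_diag, Rabs_R0, Rmult_0_r in L2.
    assert (Z : forall x, Rabs x <= 0 -> x = 0).
    { intros x Hx. apply Rabs_le_between in Hx. lra. }
    split; [|apply Rminus_diag_uniq, Z, L2].
    intro t. apply Rminus_diag_uniq, Z. specialize (L1 t).
    rewrite Hav, Rminus_diag, Rabs_R0, Rmult_0_r in L1. auto.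
Qed.

(** The derivative of the solution family with respect to its average: [z] solves the linearized
    equation with mean one, and [m] is the slope of the curve. *)
Lemma solution_differentiable T a c e u u1 u2 mu d : setting T a c e -> 0 < d ->
  solution T a c e u u1 u2 mu -> (forall t, d <= u t) ->
  exists z z1 z2 m C, 0 < C /\ has_deriv z z1 /\ has_deriv z1 z2 /\ cont z2 /\ periodic T z /\
    average T z = 1 /\ (forall t, z2 t + c * z1 t + a * g' (u t) * z t = m) /\
    forall v v1 v2 nu, solution T a c e v v1 v2 nu -> (forall t, d <= v t) ->
    (forall t, Rabs (v t - u t - (average T v - average T u) * z t)
               <= C * (average T v - average T u) ^ 2) /\
    Rabs (nu - mu - (average T v - average T u) * m) <= C * (average T v - average T u) ^ 2.
Proof.
  intros HS Hd Hu Hud. pose proof (set_T _ _ _ _ HS) as HT. pose proof (set_a _ _ _ _ HS) as Ha.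
  destruct (g'_bounded d Hd) as [L [HL HL']].
  destruct (g_taylor d Hd) as [K [HK HTay]].
  destruct (solution_lipschitz T a c e d HS Hd) as [C1 [HC1 HLip]].
  set (M := a * (3 ^ 5 / 5 ^ 5)).
  assert (HM : 0 <= M) by now apply strength_nonneg.
  destruct (coercivity T M HT HM (set_small _ _ _ _ HS)) as [A [HA Hco]].
  pose proof (sol_d1 _ _ _ _ _ _ _ _ Hu) as Du1.
  pose proof (sol_d2 _ _ _ _ _ _ _ _ Hu) as Du2.
  pose proof (sol_cont _ _ _ _ _ _ _ _ Hu) as Cu2.
  pose proof (sol_pos _ _ _ _ _ _ _ _ Hu) as Pu.
  assert (Cu : cont u) by solve_cont.
  pose proof (cont_g_comp u Cu Pu) as Cgu.
  pose proof (cont_g'_comp u Cu Pu) as Cg'u.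
  assert (HaL : 0 <= a * L) by (apply Rmult_le_pos; lra).
  assert (HN : admissible T (a * L) M (fun t x => a * g' (u t) * (1 + x))).
  { constructor.
    - intros w Hw. apply cont_mult; [|solve_cont]. apply cont_mult; [apply cont_const | auto].
    - intros t x. now rewrite (sol_per _ _ _ _ _ _ _ _ Hu).
    - intros t x y.
      replace (_ - _) with (a * g' (u t) * (x - y)) by ring.
      rewrite !Rabs_mult, (Rabs_pos_eq a) by lra.
      apply Rmult_le_compat_r; [apply Rabs_pos|]. apply Rmult_le_compat_l; [lra | auto].
    - intros t x y.
      replace (_ * _) with (a * g' (u t) * (x - y) ^ 2) by ring.
      apply Rmult_le_compat_r; [apply pow2_ge_0|].
      apply Rmult_le_compat_l; [lra|]. apply g'_le_max, Pu. }
  destruct (periodic_solution_exists T c _ _ _ HT HaL HM (set_small _ _ _ _ HS) HN)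
    as [w [w1 [w2 [m [H1 [H2 [Hc [[Hwc [Hwp Hwm]] Heq]]]]]]]].
  set (z := fun t => 1 + w t).
  assert (Dz1 : has_deriv z w1).
  { apply (has_deriv_ext z (fun t => 0 + w1 t)); auto; [intro; ring|].
    apply has_deriv_plus; auto. apply has_deriv_const. }
  assert (Pz : periodic T z) by (intro t; unfold z; now rewrite Hwp).
  assert (Cz : cont z) by solve_cont.
  assert (Hav : average T z = 1).
  { unfold z. rewrite average_add by auto. unfold average. rewrite Hwm. ring. }
  set (C2 := A * (a * K * C1 ^ 2)).
  set (C3 := a * K * C1 ^ 2).
  assert (HC3 : 0 <= C3).
  { apply Rmult_le_pos; [apply Rmult_le_pos; lra | apply pow2_ge_0]. }
  assert (HC2 : 0 <= C2) by (unfold C2; fold C3; apply Rmult_le_pos; lra).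
  exists z, w1, w2, m, (1 + C2 + C3 + a * L * C2).
  assert (HaLC : 0 <= a * L * C2) by (apply Rmult_le_pos; auto).
  repeat (split; [first [assumption | lra]|]).
  intros v v1 v2 nu Hv Hvd.
  pose proof (sol_d1 _ _ _ _ _ _ _ _ Hv) as Dv1.
  pose proof (sol_d2 _ _ _ _ _ _ _ _ Hv) as Dv2.
  pose proof (sol_cont _ _ _ _ _ _ _ _ Hv) as Cv2.
  assert (Cv : cont v) by solve_cont.
  pose proof (cont_g_comp v Cv (sol_pos _ _ _ _ _ _ _ _ Hv)) as Cgv.
  destruct (HLip v v1 v2 nu u u1 u2 mu Hv Hu Hvd Hud) as [HD _].
  set (h := average T v - average T u) in *.
  set (W := fun t => (v t - u t) - h * z t).
  set (W1 := fun t => (v1 t - u1 t) - h * w1 t).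
  set (W2 := fun t => (v2 t - u2 t) - h * w2 t).
  assert (DW1 : has_deriv W W1)
    by (apply has_deriv_minus; [now apply has_deriv_minus | now apply has_deriv_scal]).
  assert (DW2 : has_deriv W1 W2)
    by (apply has_deriv_minus; [now apply has_deriv_minus | now apply has_deriv_scal]).
  assert (CW2 : cont W2) by (unfold W2; solve_cont).
  assert (CW : cont W) by solve_cont.
  assert (PW : periodic T W).
  { intro t. unfold W.
    now rewrite Pz, (sol_per _ _ _ _ _ _ _ _ Hu), (sol_per _ _ _ _ _ _ _ _ Hv). }
  assert (MW : mean_free T W).
  { apply deviation_mean_free; auto. unfold W.
    rewrite average_sub, average_sub, average_scal, Hav by (auto; solve_cont). unfold h. ring. }
  set (f := fun t => a * (g (v t) - g (u t)) - h * (a * g' (u t) * z t)).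
  assert (Cf : cont f).
  { apply cont_minus.
    - apply cont_mult; [apply cont_const | now apply cont_minus].
    - apply cont_mult; [apply cont_const|]. apply cont_mult; auto.
      apply cont_mult; [apply cont_const | auto]. }
  assert (Eq : forall t, W2 t + c * W1 t + f t = nu - mu - h * m).
  { intro t. unfold f, W1, W2. pose proof (sol_eq _ _ _ _ _ _ _ _ Hu t).
    pose proof (sol_eq _ _ _ _ _ _ _ _ Hv t). specialize (Heq t).
    fold (z t) in Heq. rewrite <- Heq. lra. }
  set (rem := fun t => a * (g (v t) - g (u t) - g' (u t) * (v t - u t))).
  assert (Ef : forall t, f t = rem t + a * g' (u t) * W t)
    by (intro t; unfold f, rem, W; ring).
  assert (Hrem : forall t, Rabs (rem t) <= C3 * h ^ 2).
  { intro t. unfold rem. rewrite Rabs_mult, (Rabs_pos_eq a) by lra.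
    assert (G : (v t - u t) ^ 2 <= C1 ^ 2 * h ^ 2).
    { rewrite <- (pow2_abs (v t - u t)), <- (pow2_abs h), <- Rpow_mult_distr.
      apply pow_incr. split; [apply Rabs_pos | apply HD]. }
    unfold C3. rewrite !Rmult_assoc. apply Rmult_le_compat_l; [lra|].
    eapply Rle_trans; [apply HTay; auto|]. apply Rmult_le_compat_l; auto. }
  destruct (periodic_max T (fun t => W t ^ 2) HT ltac:(solve_cont)) as [t0 Ht0].
  { intro t. now rewrite PW. }
  cbv beta in Ht0. set (S := Rabs (W t0)).
  assert (HS0 : 0 <= S) by apply Rabs_pos.
  assert (HS2 : S ^ 2 = W t0 ^ 2) by apply pow2_abs.
  assert (HWS : forall t, Rabs (W t) <= S).
  { intro t. apply Rsqr_le_abs_0. specialize (Ht0 t). unfold Rsqr. lra. }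
  assert (HSh : S <= C2 * h ^ 2).
  { assert (Q : S ^ 2 <= A * (C3 * h ^ 2 * S)).
    { rewrite HS2. apply (Hco c W W1 W2 f (nu - mu - h * m)); auto; [apply MW|].
      intro t. rewrite Ef.
      assert (G1 : rem t * W t <= C3 * h ^ 2 * S).
      { eapply Rle_trans; [apply Rle_abs|]. rewrite Rabs_mult.
        apply Rmult_le_compat; auto using Rabs_pos. }
      assert (G2 : a * g' (u t) * W t ^ 2 <= M * W t ^ 2).
      { apply Rmult_le_compat_r; [apply pow2_ge_0|].
        apply Rmult_le_compat_l; [lra | apply g'_le_max, Pu]. }
      lra. }
    destruct (Req_dec S 0) as [E|Hne].
    - rewrite E. apply Rmult_le_pos; auto. apply pow2_ge_0.
    - apply Rmult_le_reg_l with S; [lra|]. unfold C2. fold C3. lra. }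
  pose proof (pow2_ge_0 h) as Hh2.
  assert (HaLC2 : 0 <= a * L * C2 * h ^ 2) by (apply Rmult_le_pos; auto).
  assert (HC3h : 0 <= C3 * h ^ 2) by (apply Rmult_le_pos; auto).
  assert (HC2h : 0 <= C2 * h ^ 2) by (apply Rmult_le_pos; auto).
  split.
  - intro t. specialize (HWS t). fold (W t). lra.
  - rewrite (constant_is_average T c W W1 W2 f (nu - mu - h * m) HT DW1 DW2) by auto.
    apply average_abs_le; auto. intro t. rewrite Ef.
    eapply Rle_trans; [apply Rabs_triang|].
    assert (G : Rabs (a * g' (u t) * W t) <= a * L * (C2 * h ^ 2)).
    { rewrite !Rabs_mult, (Rabs_pos_eq a) by lra.
      apply Rmult_le_compat; [| apply Rabs_pos | | specialize (HWS t); lra].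
      - apply Rmult_le_pos; [lra | apply Rabs_pos].
      - apply Rmult_le_compat_l; [lra | auto]. }
    specialize (Hrem t). lra.
Qed.

(** * Oscillation of solutions *)

(** Testing the equation with [u'] leaves [c int u'^2 = int e u']: the other terms are exact
    derivatives. Hence [c^2 int u'^2 <= int e^2]. *)
Lemma solution_energy T a c e u u1 u2 mu : setting T a c e -> solution T a c e u u1 u2 mu ->
  c ^ 2 * RInt (fun t => u1 t ^ 2) 0 T <= RInt (fun t => e t ^ 2) 0 T.
Proof.
  intros HS Hu. pose proof (set_T _ _ _ _ HS) as HT.
  pose proof (set_cont _ _ _ _ HS) as Ce.
  pose proof (sol_d1 _ _ _ _ _ _ _ _ Hu) as H1. pose proof (sol_d2 _ _ _ _ _ _ _ _ Hu) as H2.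
  pose proof (sol_cont _ _ _ _ _ _ _ _ Hu) as C2. pose proof (sol_pos _ _ _ _ _ _ _ _ Hu) as Pu.
  assert (Cu : cont u) by solve_cont. assert (C1 : cont u1) by solve_cont.
  pose proof (cont_g_comp u Cu Pu) as Cg.
  assert (HG : has_deriv (fun t => 1 / (2 * u t ^ 2) - 1 / (3 * u t ^ 3)) (fun t => u1 t * g (u t))).
  { intro t. apply (is_derive_comp (fun x => 1 / (2 * x ^ 2) - 1 / (3 * x ^ 3)) u); [|apply H1].
    specialize (Pu t). set (x := u t) in *. unfold g. auto_derive.
    - repeat split; apply Rgt_not_eq; repeat apply Rmult_lt_0_compat; lra.
    - field. lra. }
  pose proof (RInt_deriv _ _ 0 T H1 C1) as I0.
  pose proof (RInt_deriv _ _ 0 T (has_deriv_mult u1 u2 u1 u2 H2 H2) ltac:(solve_cont)) as I1.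
  pose proof (RInt_deriv _ _ 0 T HG ltac:(apply cont_mult; auto)) as I2.
  pose proof (sol_per _ _ _ _ _ _ _ _ Hu 0) as P0.
  pose proof (periodic_deriv T u u1 H1 (sol_per _ _ _ _ _ _ _ _ Hu) 0) as P1.
  rewrite Rplus_0_l in P0, P1. cbv beta in I0, I1, I2.
  rewrite P0 in I0, I2. rewrite P1 in I1. rewrite Rminus_diag in I0, I1, I2.
  assert (E : RInt (fun t => e t * u1 t) 0 T = c * RInt (fun t => u1 t ^ 2) 0 T).
  { rewrite (RInt_same (fun t => e t * u1 t) (fun t => / 2 * (u2 t * u1 t + u1 t * u2 t)
      + (c * u1 t ^ 2 + (a * (u1 t * g (u t)) - mu * u1 t)))).
    - assert (Cgu : cont (fun t => u1 t * g (u t))) by now apply cont_mult.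
      rewrite RInt_add, RInt_add, RInt_sub, !RInt_cmul, I0, I1, I2
        by solve_cont.
      lra.
    - intro t. pose proof (sol_eq _ _ _ _ _ _ _ _ Hu t) as Q.
      replace (e t) with (u2 t + c * u1 t + a * g (u t) - mu) by lra. field. }
  pose proof (Cauchy_Schwarz e u1 0 T ltac:(lra) Ce C1) as CS. rewrite E in CS.
  pose proof (RInt_nonneg (fun t => u1 t ^ 2) 0 T ltac:(lra) ltac:(solve_cont)
                (fun x => pow2_ge_0 (u1 x))) as NQ.
  pose proof (RInt_nonneg (fun t => e t ^ 2) 0 T ltac:(lra) ltac:(solve_cont)
                (fun x => pow2_ge_0 (e x))) as NE.
  set (Q := RInt (fun t => u1 t ^ 2) 0 T) in *. set (E2 := RInt (fun t => e t ^ 2) 0 T) in *.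
  destruct (Req_dec Q 0) as [->|Hne].
  - rewrite Rmult_0_r. auto.
  - apply Rmult_le_reg_r with Q; [lra|].
    replace (c ^ 2 * Q * Q) with ((c * Q) ^ 2) by ring. exact CS.
Qed.

(** The bound [1 / 3] is the distance from the zero [4 / 3] of [g'] to its maximum point [5 / 3]. *)
Lemma solution_oscillation T a c e u u1 u2 mu : setting T a c e -> c <> 0 ->
  sqrt (3 * T) * L2norm T e / Rabs c < 1 -> solution T a c e u u1 u2 mu ->
  forall x y, u x - u y < 1 / 3.
Proof.
  intros HS Hc Hsm Hu x y. pose proof (set_T _ _ _ _ HS) as HT.
  pose proof (set_cont _ _ _ _ HS) as Ce.
  pose proof (solution_energy T a c e u u1 u2 mu HS Hu) as HE.
  pose proof (sol_d2 _ _ _ _ _ _ _ _ Hu) as H2.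
  pose proof (oscillation_sqr_le T u u1 HT (sol_d1 _ _ _ _ _ _ _ _ Hu) ltac:(solve_cont)
    (sol_per _ _ _ _ _ _ _ _ Hu) x y) as HO.
  pose proof (RInt_nonneg (fun t => e t ^ 2) 0 T ltac:(lra) ltac:(solve_cont)
                (fun s => pow2_ge_0 (e s))) as NE.
  unfold L2norm in Hsm.
  set (Q := RInt (fun t => u1 t ^ 2) 0 T) in *. set (E2 := RInt (fun t => e t ^ 2) 0 T) in *.
  assert (Hac : 0 < Rabs c) by now apply Rabs_pos_lt.
  assert (Hlt : sqrt (3 * T) * sqrt E2 < Rabs c).
  { apply Rmult_lt_reg_r with (/ Rabs c); [now apply Rinv_0_lt_compat|].
    rewrite Rinv_r by lra. exact Hsm. }
  rewrite <- sqrt_mult in Hlt by lra.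
  assert (Hsq : 3 * T * E2 < c ^ 2).
  { assert (HTE : 0 <= 3 * T * E2) by (apply Rmult_le_pos; lra).
    rewrite <- (pow2_sqrt (3 * T * E2)), <- (pow2_abs c) by auto.
    pose proof (sqrt_pos (3 * T * E2)). nra. }
  assert (Hc2 : 0 < c ^ 2) by (rewrite <- (pow2_abs c); now apply pow_lt).
  assert (HQ : 3 * T * Q < 1).
  { apply Rmult_lt_reg_l with (c ^ 2); auto.
    replace (c ^ 2 * (3 * T * Q)) with (3 * T * (c ^ 2 * Q)) by ring.
    assert (3 * T * (c ^ 2 * Q) <= 3 * T * E2) by (apply Rmult_le_compat_l; lra). lra. }
  nra.
Qed.

(** * The curve has no local maximum *)

(** Where [(w - u) / (u - v)] is minimal, with value [r], the function [(w - u) - r (u - v)] has a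
    minimum equal to zero, so the equation gives [g w - g u <= r (g u - g v)] there. This contradicts
    strict convexity, as [w - u = r (u - v)]. *)
Lemma no_ordered_triple T a c e u u1 u2 mu v v1 v2 nu w w1 w2 la : setting T a c e ->
  solution T a c e u u1 u2 mu -> solution T a c e v v1 v2 nu -> solution T a c e w w1 w2 la ->
  (forall t, v t < u t) -> (forall t, u t < w t) -> (forall t, w t < 5 / 3) ->
  nu <= mu -> la <= mu -> False.
Proof.
  intros HS Hu Hv Hw Hvu Huw Hw53 Hnu Hla.
  pose proof (set_T _ _ _ _ HS) as HT. pose proof (set_a _ _ _ _ HS) as Ha.
  destruct Hu as [Du1 Du2 _ Pu Posu Equ]. destruct Hv as [Dv1 Dv2 _ Pv Posv Eqv].
  destruct Hw as [Dw1 Dw2 _ Pw Posw Eqw].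
  set (r := fun t => (w t - u t) * / (u t - v t)).
  destruct (periodic_min T r HT) as [p Hp].
  - apply cont_mult; [solve_cont|]. apply (cont_comp (fun t => u t - v t)); [solve_cont|].
    intro t. apply (ex_derive_continuous Rinv). auto_derive. specialize (Hvu t). lra.
  - intro t. unfold r. now rewrite Pu, Pv, Pw.
  - assert (Hr : 0 < r p).
    { apply Rmult_lt_0_compat; [specialize (Huw p); lra|].
      apply Rinv_0_lt_compat. specialize (Hvu p). lra. }
    assert (Er : w p - u p = r p * (u p - v p)).
    { unfold r. specialize (Hvu p). field. lra. }
    set (r0 := r p) in *.
    destruct (second_deriv_at_min (fun t => (w t - u t) - r0 * (u t - v t))
      (fun t => (w1 t - u1 t) - r0 * (u1 t - v1 t))
      (fun t => (w2 t - u2 t) - r0 * (u2 t - v2 t)) p) as [M1 M2].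
    + apply has_deriv_minus; [|apply has_deriv_scal]; now apply has_deriv_minus.
    + apply has_deriv_minus; [|apply has_deriv_scal]; now apply has_deriv_minus.
    + intro t. rewrite Er, Rminus_diag.
      assert (Ht : 0 < u t - v t) by (specialize (Hvu t); lra).
      replace (w t - u t) with (r t * (u t - v t)) by (unfold r; field; lra).
      specialize (Hp t). nra.
    + cbv beta in M1, M2.
      pose proof (g_chords (v p) (u p) (w p) (Posv p) (Hvu p) (Huw p) (Hw53 p)) as Ch.
      rewrite Er in Ch.
      assert (Hd : 0 < u p - v p) by (specialize (Hvu p); lra).
      assert (Ch' : r0 * (g (u p) - g (v p)) < g (w p) - g (u p)).
      { apply Rmult_lt_reg_r with (u p - v p); auto. lra. }
      assert (E : ((w2 p - u2 p) - r0 * (u2 p - v2 p)) + c * ((w1 p - u1 p) - r0 * (u1 p - v1 p))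
        = (la - mu) + r0 * (nu - mu) - a * ((g (w p) - g (u p)) - r0 * (g (u p) - g (v p)))).
      { assert (Xu : u2 p = mu + e p - c * u1 p - a * g (u p)) by (specialize (Equ p); lra).
        assert (Xv : v2 p = nu + e p - c * v1 p - a * g (v p)) by (specialize (Eqv p); lra).
        assert (Xw : w2 p = la + e p - c * w1 p - a * g (w p)) by (specialize (Eqw p); lra).
        rewrite Xu, Xv, Xw. ring. }
      rewrite M1, Rmult_0_r in E.
      assert (0 < a * ((g (w p) - g (u p)) - r0 * (g (u p) - g (v p))))
        by (apply Rmult_lt_0_compat; lra).
      assert (r0 * (nu - mu) <= 0) by nra. lra.
Qed.

Lemma nonpos_of_small_bound m C h0 : 0 < C -> 0 < h0 ->
  (forall h, 0 < h < h0 -> m <= C * h) -> m <= 0.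
Proof.
  intros HC Hh0 H. destruct (Rle_or_lt m 0) as [|Hm]; auto. exfalso.
  set (h := Rmin (h0 / 2) (m / (2 * C))).
  assert (Hq : 0 < m / (2 * C)) by (apply Rdiv_lt_0_compat; lra).
  assert (Hh : 0 < h) by (apply Rmin_pos; lra).
  pose proof (Rmin_l (h0 / 2) (m / (2 * C))). pose proof (Rmin_r (h0 / 2) (m / (2 * C))).
  fold h in H0, H1. specialize (H h ltac:(lra)).
  assert (C * h <= m / 2).
  { replace (m / 2) with (C * (m / (2 * C))) by (field; lra).
    apply Rmult_le_compat_l; lra. }
  lra.
Qed.

(** At a local maximum the slope of the curve vanishes, so the derivative [z] of the solutions
    along the curve solves the homogeneous linearized equation and is positive: nearby solutions
    are ordered like their averages. Its mean-zero condition [int g' (u) z = 0] also forces [u] to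
    take the value [4 / 3], so that all values stay below [5 / 3], where [g] is convex. *)
Lemma no_local_max T a c e u u1 u2 mu r : setting T a c e -> c <> 0 ->
  sqrt (3 * T) * L2norm T e / Rabs c < 1 -> solution T a c e u u1 u2 mu -> 0 < r ->
  (forall v v1 v2 nu, solution T a c e v v1 v2 nu ->
     Rabs (average T v - average T u) < r -> nu <= mu) -> False.
Proof.
  intros HS Hc Hsm Hu Hr Hmax.
  pose proof (set_T _ _ _ _ HS) as HT. pose proof (set_a _ _ _ _ HS) as Ha.
  pose proof (sol_pos _ _ _ _ _ _ _ _ Hu) as Pu.
  assert (Cu : cont u) by exact (has_deriv_cont _ _ (sol_d1 _ _ _ _ _ _ _ _ Hu)).
  set (xi := average T u) in *.
  assert (Hxi : 0 < xi) by (destruct (average_attained T u HT Cu) as [s Hs]; unfold xi;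
                            rewrite <- Hs; apply Pu).
  destruct (solution_lower_bound T a c e (xi / 2) HS ltac:(lra)) as [d [Hd Hlow]].
  assert (Hud : forall t, d <= u t) by (apply (Hlow u u1 u2 mu Hu); fold xi; lra).
  destruct (solution_differentiable T a c e u u1 u2 mu d HS Hd Hu Hud)
    as [z [z1 [z2 [m [C [HC [Dz1 [Dz2 [Cz2 [Pz [Az [Eqz Hdiff]]]]]]]]]]]].
  fold xi in Hdiff.
  set (h0 := Rmin r (xi / 2)).
  assert (Hh0 : 0 < h0) by (apply Rmin_pos; lra).
  assert (Hh0r : h0 <= r) by apply Rmin_l. assert (Hh0x : h0 <= xi / 2) by apply Rmin_r.
  assert (Hnear : forall h, - h0 < h < h0 -> exists v v1 v2 nu, solution T a c e v v1 v2 nu /\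
    nu <= mu /\ (forall t, Rabs (v t - u t - h * z t) <= C * h ^ 2) /\
    Rabs (nu - mu - h * m) <= C * h ^ 2).
  { intros h Hh.
    destruct (solution_exists T a c e (xi + h) HS ltac:(lra)) as [v [v1 [v2 [nu [Hv Hav]]]]].
    exists v, v1, v2, nu. split; auto.
    assert (Hdv : forall t, d <= v t) by (apply (Hlow v v1 v2 nu Hv); lra).
    destruct (Hdiff v v1 v2 nu Hv Hdv) as [D1 D2].
    rewrite Hav in D1, D2. replace (xi + h - xi) with h in D1, D2 by ring.
    split; auto. apply (Hmax v v1 v2 nu Hv). rewrite Hav.
    replace (xi + h - xi) with h by ring. apply Rabs_def1; lra. }
  assert (Hm : m = 0).
  { apply Rle_antisym.
    - apply (nonpos_of_small_bound m C h0); auto. intros h Hh.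
      destruct (Hnear h ltac:(lra)) as [v [v1 [v2 [nu [_ [Hn [_ D]]]]]]].
      apply Rabs_le_between in D. apply Rmult_le_reg_l with h; lra.
    - apply Ropp_le_cancel. rewrite Ropp_0.
      apply (nonpos_of_small_bound (- m) C h0); auto. intros h Hh.
      destruct (Hnear (- h) ltac:(lra)) as [v [v1 [v2 [nu [_ [Hn [_ D]]]]]]].
      apply Rabs_le_between in D. replace ((- h) ^ 2) with (h * h) in D by ring.
      apply Rmult_le_reg_l with h; lra. }
  rewrite Hm in Eqz. clear Hm.
  assert (Cz : cont z) by solve_cont.
  pose proof (cont_g'_comp u Cu Pu) as Cg'.
  assert (Cq : cont (fun t => a * g' (u t))) by (apply cont_mult; [apply cont_const | auto]).
  destruct (g'_bounded d Hd) as [L [HL HL']].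
  assert (Hz : forall t, 0 < z t).
  { apply (kernel_positive T c (a * (3 ^ 5 / 5 ^ 5)) (a * L) (fun t => a * g' (u t)) z z1 z2);
      auto.
    - now apply strength_nonneg.
    - apply HS.
    - intro t. apply Rmult_le_compat_l; [lra | apply g'_le_max, Pu].
    - intro t. rewrite Rabs_mult, (Rabs_pos_eq a) by lra.
      apply Rmult_le_compat_l; [lra | auto].
    - rewrite RInt_average, Az by lra. lra. }
  assert (H43 : exists s, u s = 4 / 3).
  { assert (Cqz : cont (fun t => a * g' (u t) * z t)) by now apply cont_mult.
    pose proof (constant_is_average T c z z1 z2 _ 0 HT Dz1 Dz2 Cz2 Cqz Pz Eqz) as A0.
    destruct (average_attained T _ HT Cqz) as [s Hs]. rewrite <- A0 in Hs.
    exists s. apply g'_zero; auto. specialize (Hz s).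
    apply Rmult_integral in Hs. destruct Hs as [Hs|Hs]; [|lra].
    apply Rmult_integral in Hs. destruct Hs; lra. }
  destruct H43 as [s Hs].
  destruct (periodic_max T u HT Cu (sol_per _ _ _ _ _ _ _ _ Hu)) as [p Hp].
  pose proof (solution_oscillation T a c e u u1 u2 mu HS Hc Hsm Hu p s) as Hosc.
  rewrite Hs in Hosc.
  set (gap := 5 / 3 - u p). assert (Hgap : 0 < gap) by (unfold gap; lra).
  destruct (periodic_min T z HT Cz Pz) as [q Hq].
  destruct (periodic_max T z HT Cz Pz) as [q' Hq'].
  pose proof (Hz q) as Hzq. pose proof (Hz q') as Hzq'.
  (* h so small that the error C h^2 is below h (min z), and u + h z + C h^2 is below 5 / 3 *)
  set (k := Rmin (h0 / 2) (Rmin (z q / (2 * C)) (gap / (2 * (z q' + z q))))).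
  assert (B1 : 0 < z q / (2 * C)) by (apply Rdiv_lt_0_compat; lra).
  assert (B2 : 0 < gap / (2 * (z q' + z q))) by (apply Rdiv_lt_0_compat; lra).
  assert (Hk : 0 < k) by (repeat apply Rmin_pos; lra).
  assert (Hk1 : k <= h0 / 2) by apply Rmin_l.
  assert (Hk2 : k <= z q / (2 * C)).
  { eapply Rle_trans; [apply Rmin_r | apply Rmin_l]. }
  assert (Hk3 : k <= gap / (2 * (z q' + z q))).
  { eapply Rle_trans; [apply Rmin_r | apply Rmin_r]. }
  assert (Hk2' : C * k <= z q / 2).
  { replace (z q / 2) with (C * (z q / (2 * C))) by (field; lra).
    apply Rmult_le_compat_l; lra. }
  assert (Hk3' : k * (z q' + z q) <= gap / 2).
  { replace (gap / 2) with (gap / (2 * (z q' + z q)) * (z q' + z q)) by (field; lra).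
    apply Rmult_le_compat_r; lra. }
  assert (Hk2'' : C * k ^ 2 <= k * (z q / 2)).
  { replace (C * k ^ 2) with (k * (C * k)) by ring. apply Rmult_le_compat_l; lra. }
  destruct (Hnear (- k) ltac:(lra)) as [v [v1 [v2 [nu [Hv [Hnu [Dv _]]]]]]].
  destruct (Hnear k ltac:(lra)) as [w [w1 [w2 [la [Hw [Hla [Dw _]]]]]]].
  replace ((- k) ^ 2) with (k ^ 2) in Dv by ring.
  assert (Hkz : forall t, k * z q <= k * z t) by (intro; apply Rmult_le_compat_l; auto; lra).
  assert (Hkz' : forall t, k * z t <= k * z q') by (intro; apply Rmult_le_compat_l; auto; lra).
  assert (0 < k * z q) by (apply Rmult_lt_0_compat; lra).
  apply (no_ordered_triple T a c e u u1 u2 mu v v1 v2 nu w w1 w2 la); auto; intro t;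
    specialize (Dv t); specialize (Dw t); specialize (Hkz t); specialize (Hkz' t);
    apply Rabs_le_between in Dv, Dw; [lra | lra |].
  specialize (Hp t). unfold gap in *. lra.
Qed.

(** * Shape of the curve *)

Lemma interior_max_is_local (phi : R -> R) lo hi q : 0 < lo -> lo < q < hi ->
  (forall x r, 0 < x -> 0 < r -> (forall y, 0 < y -> Rabs (y - x) < r -> phi y <= phi x) -> False) ->
  (forall s, lo <= s <= hi -> phi s <= phi q) -> False.
Proof.
  intros Hlo Hq Hno Hmax. apply (Hno q (Rmin (q - lo) (hi - q))); [lra | apply Rmin_pos; lra |].
  intros y _ Hy. apply Hmax.
  pose proof (Rmin_l (q - lo) (hi - q)). pose proof (Rmin_r (q - lo) (hi - q)).
  apply Rabs_def2 in Hy. lra.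
Qed.

(** If the conclusion failed, a maximum over a compact interval starting or ending at the global
    minimum point could be placed in the interior. *)
Lemma unimodal_of_no_local_max (phi : R -> R) X :
  (forall x, 0 < x -> continuous phi x) ->
  (forall x r, 0 < x -> 0 < r -> (forall y, 0 < y -> Rabs (y - x) < r -> phi y <= phi x) -> False) ->
  (forall B, exists d, 0 < d /\ forall x, 0 < x < d -> B < phi x) ->
  (forall eps, 0 < eps -> exists M, forall x, M < x -> Rabs (phi x) < eps) ->
  0 < X -> phi X < 0 ->
  exists xi0, 0 < xi0 /\ phi xi0 < 0 /\
    (forall x y, 0 < x -> x < y -> y < xi0 -> phi y < phi x) /\
    (forall x y, xi0 < x -> x < y -> phi x < phi y).
Proof.
  intros Hc Hno H0 Hinf HX HphiX.
  destruct (H0 (phi X)) as [d [Hd H0d]].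
  destruct (Hinf (- phi X) ltac:(lra)) as [M HM].
  set (lo := Rmin (d / 2) X). set (hi := Rmax (M + 1) X).
  assert (Hlo : 0 < lo) by (apply Rmin_pos; lra).
  assert (L1 : lo <= d / 2) by apply Rmin_l. assert (L2 : lo <= X) by apply Rmin_r.
  assert (R1 : M + 1 <= hi) by apply Rmax_l. assert (R2 : X <= hi) by apply Rmax_r.
  destruct (continuity_ab_min phi lo hi ltac:(lra)) as [xi0 [Hmin Hin]].
  { intros x Hx. apply continuity_pt_filterlim, Hc. lra. }
  assert (HminX : phi xi0 <= phi X) by (apply Hmin; lra).
  assert (Hglob : forall x, 0 < x -> phi xi0 <= phi x).
  { intros x Hx. destruct (Rlt_or_le x lo) as [h|h].
    - specialize (H0d x ltac:(lra)). lra.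
    - destruct (Rlt_or_le hi x) as [h'|h'].
      + specialize (HM x ltac:(lra)). apply Rabs_def2 in HM. lra.
      + apply Hmin. lra. }
  exists xi0. repeat split; [lra | lra | |].
  - intros x y Hx Hxy Hy. destruct (Rlt_or_le (phi y) (phi x)) as [|Hle]; auto. exfalso.
    destruct (continuity_ab_maj phi x xi0 ltac:(lra)) as [p [Hp1 Hp2]].
    { intros s Hs. apply continuity_pt_filterlim, Hc. lra. }
    destruct (Rle_or_lt (phi p) (phi y)) as [h|h].
    + apply (interior_max_is_local phi x xi0 y); auto. intros s Hs. specialize (Hp1 s Hs). lra.
    + apply (interior_max_is_local phi x xi0 p); auto.
      assert (p <> x) by (intros ->; lra).
      assert (p <> xi0) by (intros ->; pose proof (Hglob y ltac:(lra)); lra). lra.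
  - intros x y Hx Hxy. destruct (Rlt_or_le (phi x) (phi y)) as [|Hle]; auto. exfalso.
    destruct (continuity_ab_maj phi xi0 y ltac:(lra)) as [p [Hp1 Hp2]].
    { intros s Hs. apply continuity_pt_filterlim, Hc. lra. }
    destruct (Rle_or_lt (phi p) (phi x)) as [h|h].
    + apply (interior_max_is_local phi xi0 y x); auto; [lra|].
      intros s Hs. specialize (Hp1 s Hs). lra.
    + apply (interior_max_is_local phi xi0 y p); auto; [lra|].
      assert (p <> y) by (intros ->; lra).
      assert (p <> xi0) by (intros ->; pose proof (Hglob x ltac:(lra)); lra). lra.
Qed.

(** Near average zero the minimum of [u] is close to the singularity, where the force is large,
    and the force at the minimum is at most [mu + max |e|]. *)
Lemma mu_large_near_zero T a c e B : setting T a c e ->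
  exists d, 0 < d /\ forall u u1 u2 mu, solution T a c e u u1 u2 mu -> average T u < d -> B < mu.
Proof.
  intros HS. pose proof (set_T _ _ _ _ HS) as HT. pose proof (set_a _ _ _ _ HS) as Ha.
  destruct (periodic_bounded T e HT (set_cont _ _ _ _ HS) (set_per _ _ _ _ HS)) as [E [HE0 HE]].
  destruct (g_large_near_0 ((B + E) / a)) as [d [Hd Hg]].
  exists d. split; [lra|]. intros u u1 u2 mu Hu Hav.
  pose proof (sol_d1 _ _ _ _ _ _ _ _ Hu) as D1. pose proof (sol_pos _ _ _ _ _ _ _ _ Hu) as Pu.
  assert (Cu : cont u) by solve_cont.
  destruct (average_attained T u HT Cu) as [s Hs].
  assert (Hxi : 0 < average T u) by (rewrite <- Hs; auto).
  destruct (force_at_min_le T c (fun x => a * g x) e E (a * / average T u ^ 4) u u1 u2 mu)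
    as [m [M1 [M2 _]]]; auto; try apply Hu.
  { intros x Hx. apply Rmult_le_compat_l; [lra | now apply g_le_above]. }
  specialize (M1 s). specialize (Hg (u m) (Pu m) ltac:(lra)).
  apply Rmult_lt_compat_l with (r := a) in Hg; auto.
  replace (a * ((B + E) / a)) with (B + E) in Hg by (field; lra). lra.
Qed.

Lemma mu_is_force_value T a c e u u1 u2 mu : setting T a c e -> solution T a c e u u1 u2 mu ->
  exists s, mu = a * g (u s).
Proof.
  intros HS Hu. pose proof (set_T _ _ _ _ HS) as HT.
  pose proof (set_cont _ _ _ _ HS) as Ce.
  pose proof (sol_d1 _ _ _ _ _ _ _ _ Hu) as D1. pose proof (sol_d2 _ _ _ _ _ _ _ _ Hu) as D2.
  pose proof (sol_pos _ _ _ _ _ _ _ _ Hu) as Pu.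
  assert (Cu : cont u) by solve_cont.
  assert (Cg : cont (fun t => a * g (u t)))
    by (apply cont_mult; [apply cont_const | now apply cont_g_comp]).
  destruct (average_attained T _ HT Cg) as [s Hs]. exists s. rewrite Hs.
  rewrite (constant_is_average T c u u1 u2 (fun t => a * g (u t) - e t) mu HT D1 D2);
    try apply Hu; [| now apply cont_minus |].
  - rewrite average_sub by auto.
    assert (E : average T e = 0) by (unfold average; rewrite (set_mean _ _ _ _ HS); ring).
    rewrite E. ring.
  - intro t. pose proof (sol_eq _ _ _ _ _ _ _ _ Hu t). lra.
Qed.

Lemma mu_at_infinity T a c e eps : setting T a c e -> c <> 0 ->
  sqrt (3 * T) * L2norm T e / Rabs c < 1 -> 0 < eps ->
  exists M, 0 < M /\ forall u u1 u2 mu, solution T a c e u u1 u2 mu -> M < average T u ->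
    - eps < mu < 0.
Proof.
  intros HS Hc Hsm Heps.
  pose proof (set_T _ _ _ _ HS) as HT. pose proof (set_a _ _ _ _ HS) as Ha.
  assert (Hq : 0 < a / eps) by (apply Rdiv_lt_0_compat; lra).
  exists (2 + a / eps). split; [lra|]. intros u u1 u2 mu Hu Hav.
  pose proof (sol_d1 _ _ _ _ _ _ _ _ Hu) as D1. assert (Cu : cont u) by solve_cont.
  destruct (average_attained T u HT Cu) as [s Hs].
  destruct (mu_is_force_value T a c e u u1 u2 mu HS Hu) as [p Hp].
  pose proof (solution_oscillation T a c e u u1 u2 mu HS Hc Hsm Hu s p) as Ho.
  assert (Hup : 1 + a / eps < u p) by lra.
  pose proof (g_neg (u p) ltac:(lra)) as G1. pose proof (g_small (u p) ltac:(lra)) as G2.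
  rewrite Rabs_left in G2 by auto.
  assert (G3 : / u p < eps / a).
  { replace (eps / a) with (/ (a / eps)) by (field; lra).
    apply Rinv_lt_contravar; [apply Rmult_lt_0_compat|]; lra. }
  assert (G4 : a * (- g (u p)) < a * (eps / a)) by (apply Rmult_lt_compat_l; lra).
  replace (a * (eps / a)) with eps in G4 by (field; lra).
  rewrite Hp. split; [lra|]. nra.
Qed.

(** Local Lipschitz continuity, from the stability of solutions with averages bounded below. *)
Lemma curve_continuous T a c e phi : setting T a c e ->
  (forall xi, 0 < xi -> exists u u1 u2, solution T a c e u u1 u2 (phi xi) /\ average T u = xi) ->
  forall xi, 0 < xi -> continuous phi xi.
Proof.
  intros HS Hphi xi Hxi.
  destruct (solution_lower_bound T a c e (xi / 2) HS ltac:(lra)) as [d [Hd Hlow]].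
  destruct (solution_lipschitz T a c e d HS Hd) as [C [HC HL]].
  destruct (Hphi xi Hxi) as [u [u1 [u2 [Hu Hau]]]].
  apply (filterlim_locally phi (phi xi)). intro eps. pose proof (cond_pos eps) as Heps.
  assert (Hr : 0 < Rmin (xi / 2) (eps / C))
    by (apply Rmin_pos; [lra | apply Rdiv_lt_0_compat; lra]).
  exists (mkposreal _ Hr). intros y Hy.
  change (Rabs (y - xi) < Rmin (xi / 2) (eps / C)) in Hy.
  change (Rabs (phi y - phi xi) < eps).
  pose proof (Rmin_l (xi / 2) (eps / C)). pose proof (Rmin_r (xi / 2) (eps / C)).
  assert (Hyx : Rabs (y - xi) < xi / 2) by lra. apply Rabs_def2 in Hyx.
  destruct (Hphi y ltac:(lra)) as [v [v1 [v2 [Hv Hav]]]].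
  destruct (HL v v1 v2 (phi y) u u1 u2 (phi xi) Hv Hu) as [_ L2].
  - apply (Hlow v v1 v2 (phi y) Hv). lra.
  - apply (Hlow u u1 u2 (phi xi) Hu). lra.
  - rewrite Hav, Hau in L2. eapply Rle_lt_trans; [exact L2|].
    replace (pos eps) with (C * (eps / C)) by (field; lra).
    apply Rmult_lt_compat_l; lra.
Qed.

Theorem theorem6p1 (T omega a c : R) (e : R -> R)
  (hT : 0 < T) (homega : omega = 2 * PI / T)
  (he_cont : forall t, continuous e t) (he_per : periodic T e)
  (he_mean : RInt e 0 T = 0)
  (ha : 0 < a) (hc : c <> 0)
  (ha_omega : a * (3 ^ 5 / 5 ^ 5) < omega ^ 2)
  (he_small : sqrt (3 * T) * L2norm T e / Rabs c < 1) :
  (forall u1 mu1 u2 mu2,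
     solution_pair T a c e u1 mu1 -> solution_pair T a c e u2 mu2 ->
     average T u1 = average T u2 ->
     (forall t, u1 t = u2 t) /\ mu1 = mu2) /\
  exists phi : R -> R,
    solution_curve T a c e phi /\
    (forall psi : R -> R, solution_curve T a c e psi ->
       forall xi, 0 < xi -> psi xi = phi xi) /\
    (exists xi0 : R, 0 < xi0 /\ phi xi0 < 0 /\
       (forall x y, 0 < x -> x < y -> y < xi0 -> phi y < phi x) /\
       (forall x y, xi0 < x -> x < y -> phi x < phi y)) /\
    filterlim phi (at_right 0) (Rbar_locally p_infty) /\
    is_lim phi p_infty 0.
Proof.
  assert (HS : setting T a c e) by (constructor; auto; rewrite <- homega; auto).
  assert (Huniq : forall u1 mu1 u2 mu2,
     solution_pair T a c e u1 mu1 -> solution_pair T a c e u2 mu2 ->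
     average T u1 = average T u2 -> (forall t, u1 t = u2 t) /\ mu1 = mu2).
  { intros u1 mu1 u2 mu2 H1 H2.
    exact (solution_unique T a c e _ _ _ _ _ _ _ _ HS
             (solution_pair_solution T a c e u1 mu1 he_cont H1)
             (solution_pair_solution T a c e u2 mu2 he_cont H2)). }
  split; [exact Huniq|].
  assert (Hex : forall xi, exists mu, 0 < xi ->
     exists u u1 u2, solution T a c e u u1 u2 mu /\ average T u = xi).
  { intro xi. destruct (Rlt_dec 0 xi) as [h|h]; [|now exists 0].
    destruct (solution_exists T a c e xi HS h) as [u [u1 [u2 [mu H]]]].
    exists mu. intros _. now exists u, u1, u2. }
  set (phi := fun xi => proj1_sig (constructive_indefinite_description _ (Hex xi))).
  assert (Hphi : forall xi, 0 < xi ->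
     exists u u1 u2, solution T a c e u u1 u2 (phi xi) /\ average T u = xi)
    by (intro xi; apply (proj2_sig (constructive_indefinite_description _ (Hex xi)))).
  clearbody phi.
  assert (Hpos : forall u mu, solution_pair T a c e u mu -> 0 < average T u).
  { intros u mu H. pose proof (proj1 H) as Pu.
    apply (solution_pair_solution T a c e u mu he_cont) in H.
    destruct (average_attained T u hT) as [s Hs].
    - exact (has_deriv_cont _ _ (sol_d1 _ _ _ _ _ _ _ _ H)).
    - rewrite <- Hs. apply Pu. }
  assert (Hon : forall u mu, solution_pair T a c e u mu -> mu = phi (average T u)).
  { intros u mu H. destruct (Hphi _ (Hpos u mu H)) as [v [v1 [v2 [Hv Hav]]]].
    apply (Huniq u mu v (phi (average T u)) H); auto.
    exact (solution_solution_pair T a c e v v1 v2 _ Hv). }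
  pose proof (curve_continuous T a c e phi HS Hphi) as Hcont.
  assert (H0 : forall B, exists d, 0 < d /\ forall x, 0 < x < d -> B < phi x).
  { intro B. destruct (mu_large_near_zero T a c e B HS) as [d [Hd H]].
    exists d. split; auto. intros x Hx.
    destruct (Hphi x ltac:(lra)) as [u [u1 [u2 [Hu Hau]]]].
    apply (H u u1 u2 (phi x) Hu). lra. }
  assert (Hinf : forall eps, 0 < eps -> exists M, 0 < M /\ forall x, M < x -> - eps < phi x < 0).
  { intros eps Heps.
    destruct (mu_at_infinity T a c e eps HS hc he_small Heps) as [M [HM H]].
    exists M. split; auto. intros x Hx.
    destruct (Hphi x ltac:(lra)) as [u [u1 [u2 [Hu Hau]]]].
    apply (H u u1 u2 (phi x) Hu). lra. }
  exists phi. split; [|split; [|split; [|split]]].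
  - split; [auto | split; auto]. intros xi Hxi.
    destruct (Hphi xi Hxi) as [u [u1 [u2 [Hu Hau]]]]. exists u. split; auto.
    exact (solution_solution_pair T a c e u u1 u2 _ Hu).
  - intros psi [_ [_ Hpsi]] xi Hxi. destruct (Hpsi xi Hxi) as [u [Hu Hau]].
    rewrite (Hon u (psi xi) Hu), Hau. reflexivity.
  - destruct (Hinf 1 Rlt_0_1) as [M [HM H]].
    apply (unimodal_of_no_local_max phi (M + 1)); auto.
    + intros x r Hx Hr Hmax. destruct (Hphi x Hx) as [u [u1 [u2 [Hu Hau]]]].
      apply (no_local_max T a c e u u1 u2 (phi x) r HS hc he_small Hu Hr).
      intros v v1 v2 nu Hv Hav.
      pose proof (solution_solution_pair T a c e v v1 v2 nu Hv) as Hv'.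
      rewrite (Hon v nu Hv'). apply Hmax; [exact (Hpos v nu Hv')|]. now rewrite <- Hau.
    + intros eps Heps. destruct (Hinf eps Heps) as [M' [_ H']].
      exists M'. intros x Hx. specialize (H' x Hx). apply Rabs_def1; lra.
    + lra.
    + apply H. lra.
  - intros P [B HB]. destruct (H0 B) as [d [Hd Hd']].
    exists (mkposreal d Hd). intros x Hx Hx0.
    change (Rabs (x - 0) < d) in Hx. rewrite Rminus_0_r in Hx. apply Rabs_def2 in Hx.
    apply HB, Hd'. lra.
  - apply is_lim_spec. intro eps. destruct (Hinf eps (cond_pos eps)) as [M [_ H]].
    exists M. intros x Hx. specialize (H x Hx). rewrite Rminus_0_r. apply Rabs_def1; lra.
Qed.
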